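(* Let $(\Omega,\mathcal F,\mathbb P)$ be a probability space with a filtration $\mathbb F=(\mathcal F_t)_{t\ge 0}$ satisfying the usual conditions, and let $0<L<U$ be constants. Let $\eta$ be an $\mathbb F$-predictable process with $L\le\eta\le U$ $(\mathbb P\otimes dt)$-a.e., and let $\lambda:\mathbb R_+\times\mathbb N\to\mathbb R_+$ be a measurable function such that $L\le\lambda(\cdot,x)\le U$ Lebesgue-a.e. for each $x\in\mathbb N$. Suppose that $\Omega$ supports a sequence of i.i.d. $\operatorname{Exp}(1)$ random variables $(E_k)_{k\ge 1}$ which is independent of $\mathcal F_\infty$. Then there exist an enlarged filtration $\mathbb G\supseteq\mathbb F$ on $\Omega$ (satisfying the usual conditions) and a counting process $X$ adapted to $\mathbb G$ such that the process $$X_t-\int_0^t\frac{\eta_s}{\mathbb E[\eta_s\mid X_{s-}]}\,\lambda(s,X_{s-})\,ds,\qquad t\ge 0,$$ is a $\mathbb G$-martingale.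
   Context: $\mathbb R_+=[0,\infty)$, $\mathbb N=\{0,1,2,\dots\}$. A filtration $\mathbb F$ satisfies the usual conditions if it is right-continuous and $\mathcal F_0$ contains all $\mathbb P$-null sets. $\mathcal F_\infty:=\bigvee_{t\ge 0}\mathcal F_t$. $\mathbb F\subseteq\mathbb G$ means $\mathcal F_t\subseteq\mathcal G_t$ for all $t\ge 0$. A counting process is a jump process of the form $X_t=\sum_{k=1}^\infty \mathbf 1_{\{\tau_k\le t\}}$, $t\ge 0$, with random times $0<\tau_1<\tau_2<\cdots$ $\mathbb P$-a.s. All semimartingales (in particular martingales) have càdlàg sample paths. $\mathbb E[\eta_s\mid X_{s-}]$ is understood as $\gamma(s,X_{s-})$ for a measurable, strictly positive function $\gamma$ such that $\gamma(s,X_{s-})=\mathbb E[\eta_s\mid X_{s-}]$ $\mathbb P$-a.s. for Lebesgue-a.e. $s\ge 0$. *)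

(* Defs.v *)
From HB Require Import structures.
From mathcomp Require Import all_boot all_order all_algebra.
From mathcomp Require Import all_classical all_reals all_analysis.
From mathcomp Require Import measurable_realfun.

Set Implicit Arguments.
Unset Strict Implicit.
Unset Printing Implicit Defensive.

Import Order.TTheory GRing.Theory Num.Theory.
Import numFieldNormedType.Exports.

Local Open Scope classical_set_scope.
Local Open Scope ring_scope.

(* The time set [0, +oo[ is handled as a subset of R: families indexed by time
   are functions on R whose values at negative times are never constrained. *)

Definition measurable_time_state {R : realType} (f : R -> nat -> R) :=
  measurable_fun ((`[0, +oo[ : set R) `*` [set: nat])
    (fun p : R * nat => f p.1 p.2).

Section filtrations.
Context {d : measure_display} {T : measurableType d} {R : realType}.
Implicit Types F G : R -> set_system T.

Definition filtration F :=
  [/\ forall t, 0 <= t -> sigma_algebra [set: T] (F t),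
      forall t, 0 <= t -> F t `<=` measurable
    & forall s t, 0 <= s -> s <= t -> F s `<=` F t].

(* Null sets are the events of probability 0; the ambient sigma-algebra need
   not be complete. *)
Definition usual_conditions (P : probability T R) F :=
  [/\ filtration F,
      forall t, 0 <= t -> F t = \bigcap_(s in `]t, +oo[) F s
    & forall A, measurable A -> P A = 0%E -> F 0 A].

Definition enlarges F G := forall t, 0 <= t -> F t `<=` G t.

Definition filtration_infty F : set_system T :=
  <<s \bigcup_(t in `[0, +oo[) F t >>.

End filtrations.

Definition measurable_wrt {T : Type} {d' : measure_display}
    {Y : measurableType d'} (S : set_system T) (f : T -> Y) :=
  preimage_set_system [set: T] f measurable `<=` S.

Section processes.
Context {d : measure_display} {T : measurableType d} {R : realType}.
Implicit Types F : R -> set_system T.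

Definition adapted {d' : measure_display} {Y : measurableType d'} F
    (X : R -> T -> Y) :=
  forall t, 0 <= t -> measurable_wrt (F t) (X t).

Definition left_continuous_paths (X : R -> T -> R) :=
  forall w t, 0 < t -> X s w @[s --> t^'-] --> X t w.

(* The sigma-algebra on T * [0, +oo[ generated by the left-continuous adapted
   processes. *)
Definition predictable_sigma F : set_system (T * R) :=
  let D := [set: T] `*` `[0, +oo[ in
  <<s D, \bigcup_(X in [set X : R -> T -> R |
                          adapted F X /\ left_continuous_paths X])
           preimage_set_system D (fun p : T * R => X p.2 p.1) measurable >>.

Definition predictable F (X : R -> T -> R) :=
  preimage_set_system ([set: T] `*` `[0, +oo[)
    (fun p : T * R => X p.2 p.1) measurable `<=` predictable_sigma F.

Definition cadlag (f : R -> R) :=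
  (forall t, 0 <= t -> f s @[s --> t^'+] --> f t) /\
  (forall t, 0 < t -> cvg (f s @[s --> t^'-])).

(* X_{t-}; at t = 0 it depends on the values of X at negative times, hence is
   only meaningful for t > 0. *)
Definition left_limit (X : R -> T -> nat) (t : R) (w : T) : nat :=
  lim (X s w @[s --> t^'-]).

End processes.

Section probability.
Context {d : measure_display} {T : measurableType d} {R : realType}.
Variable P : probability T R.

(* Z is a version of the conditional expectation of Y given S. *)
Definition is_cond_expectation (S : set_system T) (Y Z : T -> R) :=
  [/\ P.-integrable [set: T] (EFin \o Y),
      P.-integrable [set: T] (EFin \o Z),
      measurable_wrt S Z
    & forall A, S A ->
        (\int[P]_(w in A) (Z w)%:E = \int[P]_(w in A) (Y w)%:E)%E].

(* Cadlag paths are required almost surely: the values of a Lebesgue integral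
   process are arbitrary where the integrand is not locally integrable. *)
Definition martingale (F : R -> set_system T) (M : R -> T -> R) :=
  [/\ adapted F M,
      forall t, 0 <= t -> P.-integrable [set: T] (EFin \o M t),
      forall s t, 0 <= s -> s <= t -> is_cond_expectation (F s) (M t) (M s)
    & {ae P, forall w, cadlag (M ^~ w)}].

(* X is nat-valued, so the last clause includes that only finitely many jumps
   occur in any bounded time interval; it makes every path of X cadlag. *)
Definition counting_process (X : R -> T -> nat) :=
  exists tau : nat -> T -> \bar R,
  [/\ forall k, measurable_fun [set: T] (tau k),
      {ae P, forall w, (0 < tau 0%N w)%E /\
                       forall k, (tau k w < tau k.+1 w)%E}
    & forall t w, 0 <= t ->
        ((X t w)%:R%:E = \sum_(0 <= k <oo) (tau k w <= t%:E)%E%:R%:E :> \bar R)%E].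

Definition mutually_independent (E : nat -> T -> R) :=
  forall (s : seq nat) (B : nat -> set R), uniq s ->
    (forall k, measurable (B k)) ->
    (P (\bigcap_(k in [set` s]) (E k @^-1` B k)) =
     \prod_(k <- s) P (E k @^-1` B k))%E.

Definition exp1_distributed (Y : T -> R) :=
  forall B, measurable B -> P (Y @^-1` B) = exponential_prob 1 B.

Definition sigma_of_sequence (E : nat -> T -> R) : set_system T :=
  <<s \bigcup_k preimage_set_system [set: T] (E k) measurable >>.

Definition independent_classes (S S' : set_system T) :=
  forall A B, S A -> S' B -> P (A `&` B) = (P A * P B)%E.

End probability.

(* Main.v *)
(* Write lam_k = lambda(., k), let e be eta clipped to [L, U] and H_k be the
   sigma-algebra generated by F_oo and E_0, ..., E_{k-1}. The jump times are built
   one after the other: given tau_k, measurable with respect to H_k, and a function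
   g_k of time with values in [L, U], put
     y_k(t) = int_{tau_k}^t e_s lam_k(s) / g_k(s) ds   and
     tau_{k+1} = inf {t >= tau_k | y_k(t) >= E_k}.
   As E_k is exponential and independent of H_k, the conditional probability of
   tau_k <= t < tau_{k+1} given H_k is 1_{tau_k <= t} exp(- y_k(t)), so that
   g_k(t) = E[eta_t | X_t = k] becomes the fixed-point equation
     g(t) = E[e_t 1_{tau_k <= t} exp(- y_g(t))] / E[1_{tau_k <= t} exp(- y_g(t))].
   On [0, T] the difference of the right-hand sides for g and g' is at most
   K_T int_0^t |g - g'|: the numerator is controlled by P(tau_k <= t) and the
   denominator is at least exp(- c T) P(tau_k <= t), so P(tau_k <= t) cancels.
   Hence the Picard iterates converge.

   G_t consists of the events which, for every k, coincide on {X_t <= k} with an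
   event of H_k. It contains F_oo, and monotonicity and right-continuity are
   immediate. For B in H_k one has E[1_B 1_{E_k <= y}] = E[1_B min(E_k, y)] with
   y = y_k(t), while min(E_k, y_k(t)) is the integral of the intensity over
   [tau_k, tau_{k+1}[ up to time t; summing over k gives the martingale property.
   Taking B = Omega shows that the expected number of jumps before t is at most
   linear in t, so that the process does not explode. *)
Require Import Defs.
From HB Require Import structures.
From mathcomp Require Import all_boot all_order all_algebra.
From mathcomp Require Import all_classical all_reals all_analysis.
From mathcomp Require Import measurable_realfun ring lra.
Set Implicit Arguments.
Unset Strict Implicit.
Unset Printing Implicit Defensive.
Import Order.TTheory GRing.Theory Num.Theory.
Import numFieldNormedType.Exports.
Local Open Scope classical_set_scope.
Local Open Scope ring_scope.

(** * Cumulative rates and passage times *)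

(** The intensity involves the law of the very process to be built. This circularity stays within
    one level: E[eta_t | X_t = k] depends on [tau k] and on the rate out of level k, not on later
    jumps. Each level thus needs a fixed point for one deterministic function of time, and the
    levels can be solved in succession. Revealing all of F_oo at time 0 makes the rate out of level
    k known given H_k, so that E_k alone decides when the next jump occurs. On [0, Tm] the
    fixed-point map halves distances in the sup norm weighted by exp(- b t), with b depending on Tm.
    Its quotient is clipped to [L, U], which keeps all rates between positive constants. Null sets
    are removed in two ways: clipping the data makes their bounds hold everywhere, and paths with
    some E_k <= 0 or with accumulating jumps are replaced by paths without jumps. Adaptedness
    survives because G_0 contains the null events. For each path X_{s-} and X_s differ at countably
    many s only, so that time integrals and conditional expectations at almost every s may be
    computed with X_s. *)

Section cumulative_rate.
Context {R : realType}.
Local Notation mu := (@lebesgue_measure R).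
Implicit Types (f g : R -> R) (a c C t u v : R).

Lemma integrable_bounded_itv f C a t : measurable_fun setT f ->
  (forall r, `|f r| <= C) -> mu.-integrable `[a, t] (EFin \o f).
Proof.
move=> mf fC; apply: measurable_bounded_integrable => //.
- by rewrite /= lebesgue_measure_itv /=; case: ifP => // _; rewrite -EFinB ltry.
- exact: measurable_funTS.
- exists C; split; first by rewrite num_real.
  by move=> M CM r _; apply: (le_trans (fC r)); exact: ltW.
Qed.

(** The interval is empty for [t < a], so the value is 0 there; monotonicity and the Lipschitz bound
    then hold on the whole time axis. *)
Definition cumul f a t := \int[mu]_(s in `[a, t]) f s.

Lemma cumul_lt f a t : t < a -> cumul f a t = 0.
Proof. by move=> ta; rewrite /cumul set_itv_ge ?Rintegral_set0// bnd_simp -ltNge. Qed.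

Lemma cumul_cst a t C : a <= t -> cumul (cst C) a t = C * (t - a).
Proof.
move=> at_; rewrite /cumul Rintegral_cst //= lebesgue_measure_itv /= lte_fin.
case: ltP => [_|ta] //=.
by have -> : t = a; [apply/eqP; rewrite eq_le ta | rewrite subrr].
Qed.

Section bounded_rate.
Variables (f : R -> R) (C : R).
Hypotheses (mf : measurable_fun setT f) (fC : forall r, 0 <= f r <= C).

Let normf r : `|f r| <= C.
Proof. by have /andP[f0 fC'] := fC r; rewrite ger0_norm. Qed.

Let C_ge0 : 0 <= C.
Proof. by have /andP[] := fC 0; exact: le_trans. Qed.

Lemma cumul_integrable a t : mu.-integrable `[a, t] (EFin \o f).
Proof. exact: integrable_bounded_itv. Qed.

Lemma cumul_ge0 a t : 0 <= cumul f a t.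
Proof. by apply: Rintegral_ge0 => r _; have /andP[] := fC r. Qed.

Lemma cumul_le a t : a <= t -> cumul f a t <= C * (t - a).
Proof.
move=> at_; rewrite -(@cumul_cst a t C) //; apply: le_Rintegral => //.
- exact: cumul_integrable.
- by apply: (@integrable_bounded_itv _ C) => // r; rewrite ger0_norm.
- by move=> r _; have /andP[] := fC r.
Qed.

Lemma cumul_ge c a t : 0 <= c -> (forall r, c <= f r) -> a <= t ->
  c * (t - a) <= cumul f a t.
Proof.
move=> c0 cf at_; rewrite -(@cumul_cst a t c) //; apply: le_Rintegral => //.
- by apply: (@integrable_bounded_itv _ c) => // r; rewrite ger0_norm.
- exact: cumul_integrable.
Qed.

Lemma cumul_split a u t : a <= u -> u <= t ->
  cumul f a t = cumul f a u + cumul f u t.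
Proof.
move=> au ut.
have := @Rintegral_itvB _ f (BLeft a) (BRight t) u (cumul_integrable a t).
rewrite !bnd_simp => /(_ au ut) /eqP; rewrite subr_eq addrC => /eqP.
rewrite /cumul => ->; congr (_ + _); apply: Rintegral_itv_obnd_cbnd.
apply: (@integrableS _ _ _ mu `[u, t]) => //; last exact: cumul_integrable.
by apply: subset_itvr; rewrite bnd_simp.
Qed.

Lemma cumul_homo a : {homo cumul f a : u t / u <= t}.
Proof.
move=> u t ut; case: (leP a u) => [au|ua]; last by rewrite cumul_lt // cumul_ge0.
by rewrite (@cumul_split a u t) // lerDl cumul_ge0.
Qed.

Lemma cumul_lipschitz a u t : u <= t ->
  cumul f a t - cumul f a u <= C * (t - u).
Proof.
move=> ut; case: (leP a u) => [au|ua].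
  by rewrite (@cumul_split a u t) // addrAC subrr add0r cumul_le.
rewrite (cumul_lt _ ua) subr0; case: (leP a t) => [at_|ta].
  by apply: (le_trans (cumul_le at_)); apply: ler_wpM2l => //; lra.
by rewrite cumul_lt // mulr_ge0 // subr_ge0.
Qed.

End bounded_rate.

(** For rates between two positive constants the set is nonempty and the infimum is attained; for
    [v <= 0] it is [a] itself. *)
Definition passage f a v : R := inf [set t | a <= t /\ v <= cumul f a t].

Section passage_time.
Variables (f : R -> R) (c C : R).
Hypotheses (mf : measurable_fun setT f) (fC : forall r, 0 <= f r <= C).
Hypotheses (c_gt0 : 0 < c) (cf : forall r, c <= f r).

Let C_gt0 : 0 < C.
Proof.
by apply: (lt_le_trans c_gt0); apply: (le_trans (cf 0)); have /andP[] := fC 0.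
Qed.

Let D a v := [set t | a <= t /\ v <= cumul f a t].

Let D_lb a v : lbound (D a v) a. Proof. by move=> t []. Qed.

Let D_neq0 a v : D a v !=set0.
Proof.
(* A rate of at least [c] accumulates [|v|] within a duration [|v| / c]. *)
exists (a + `|v| / c); split; first by rewrite lerDl divr_ge0 // ltW.
apply: le_trans (cumul_ge mf fC (ltW c_gt0) cf _); last first.
  by rewrite lerDl divr_ge0 // ltW.
by rewrite addrAC subrr add0r mulrCA divff ?mulr1 ?ler_norm // gt_eqF.
Qed.

Lemma passage_ge a v : a <= passage f a v.
Proof. by apply: lb_le_inf; [exact: D_neq0 | exact: D_lb]. Qed.

(** Some time of the set lies within [e / C] of its infimum, and moving back by that much costs at
    most [e], since the cumulative rate is [C]-Lipschitz. *)
Lemma cumul_passage_ge a v : v <= cumul f a (passage f a v).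
Proof.
apply/ler_addgt0Pr => e e0.
have eC : 0 < e / C by rewrite divr_gt0.
have hi : has_inf (D a v) by split; [exact: D_neq0 | exists a; exact: D_lb].
have [t [at_ vt] tp] := inf_adherent eC hi.
have pt : passage f a v <= t by apply: ge_inf; [exists a; exact: D_lb | split].
apply: (le_trans vt).
have := cumul_lipschitz mf fC a pt.
have : C * (t - passage f a v) <= e.
  rewrite mulrC -ler_pdivlMr // lerBlDl.
  by apply: ltW; move: tp; rewrite -/(passage f a v).
lra.
Qed.

(** This Galois connection turns events about jump times into comparisons of an exponential variable
    with a cumulative rate; measurability and conditional laws are both read off from it. *)
Lemma passage_le a v t : passage f a v <= t <-> a <= t /\ v <= cumul f a t.
Proof.
split=> [pt|Dt]; last by apply: ge_inf => //; exists a; exact: D_lb.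
split; first exact: le_trans (passage_ge a v) pt.
apply: le_trans (cumul_passage_ge a v) _; exact: (cumul_homo mf fC).
Qed.

(** There is no overshoot: at time [e / C] before the passage the level [v] is not exceeded, and at
    most [e] is added afterwards. Before [a] this uses [0 <= v]. *)
Lemma cumul_passage a v : 0 <= v -> cumul f a (passage f a v) = v.
Proof.
move=> v0; apply/eqP; rewrite eq_le cumul_passage_ge andbT.
apply/ler_addgt0Pr => e e0.
set p := passage f a v; set u := p - e / C.
have up : u < p by rewrite ltrBlDr ltrDl divr_gt0.
have uv : cumul f a u <= v.
  case: (leP a u) => au; last by rewrite cumul_lt.
  rewrite leNgt; apply/negP => vu; move: up; rewrite ltNge => /negP; apply.
  by apply/passage_le; split => //; exact: ltW.
have := cumul_lipschitz mf fC a (ltW up).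
have -> : C * (p - u) = e.
  by rewrite /u opprB addrCA subrr addr0 mulrCA divff ?mulr1 // gt_eqF.
lra.
Qed.

(** Stopping in time and capping in value coincide because the cumulative rate is nondecreasing and
    equals [v] at the passage time. *)
Lemma cumul_min_passage a v t : 0 <= v ->
  cumul f a (Num.min t (passage f a v)) = Num.min v (cumul f a t).
Proof.
move=> v0; case: (leP t (passage f a v)) => tp.
  case: (leP v (cumul f a t)) => // vt; apply/eqP; rewrite eq_le vt andbT.
  by rewrite -[leRHS](cumul_passage a v0); apply: (cumul_homo mf fC).
rewrite cumul_passage //; case: (leP v (cumul f a t)) => // cv.
by move/ltW: tp => /passage_le[_]; rewrite leNgt cv.
Qed.

Lemma integral_before_passage a v t : 0 <= a -> 0 <= v ->
  (\int[mu]_(r in `[0%R, t])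
     ((a <= r < passage f a v)%R%:R * f r)%:E = (Num.min v (cumul f a t))%:E)%E.
Proof.
move=> a0 v0; rewrite -cumul_min_passage //.
set p := passage f a v.
transitivity (\int[mu]_(r in `[0%R, t] `&` `[a, p[) (f r)%:E)%E.
  rewrite integral_mkcondr; apply: eq_integral => r _.
  rewrite patchE mem_setE in_itv /=; case: ifP => _; first by rewrite mul1r.
  by rewrite mul0r.
have /(_ _)/fineK intE (x : R) : (\int[mu]_(r in `[a, x]) (f r)%:E)%E \is a fin_num.
  by apply: integrable_fin_num => //; exact: cumul_integrable mf fC _ _.
case: (ltP t p) => tp.
  rewrite /cumul /Rintegral intE; congr (integral _ _ _).
  apply/seteqP; split => r /=; rewrite !in_itv /=; first by move=> [/andP[_ ->] /andP[->]].
  by move=> /andP[ar rt]; rewrite ar rt (le_trans a0 ar) (le_lt_trans rt tp).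
have -> : `[0%R, t] `&` `[a, p[ = `[a, p[%classic :> set R.
  apply/seteqP; split => r /=; rewrite !in_itv /=; first by case.
  move=> /andP[ar rp]; rewrite ar rp (le_trans a0 ar); split => //.
  by apply: ltW; exact: lt_le_trans tp.
rewrite integral_itv_bndo_bndc ?intE //.
exact/measurable_EFinP/measurable_funTS.
Qed.

End passage_time.
End cumulative_rate.

Section measurable_parameter.
Context {d : measure_display} {S : measurableType d} {R : realType}.
Local Notation mu := (@lebesgue_measure R).

Lemma measurable_natr (b : S -> bool) : measurable_fun setT b ->
  measurable_fun setT (fun w => (b w)%:R : R).
Proof.
move=> mb; rewrite (_ : (fun _ => _) = fun w => if b w then 1 else 0); last first.
  by apply/funext => w; case: (b w).
exact: measurable_fun_ifT.
Qed.

Lemma measurable_bool_set (b : S -> bool) : measurable_fun setT b ->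
  measurable [set w | b w].
Proof.
by move=> mb; rewrite -[X in measurable X]setTI; exact: (mb measurableT [set true]).
Qed.

(** On positive reals the inverse is exp(- ln), a composition of measurable maps. *)
Lemma measurable_inv_pos (g : S -> R) : measurable_fun setT g ->
  (forall w, 0 < g w) -> measurable_fun setT (fun w => (g w)^-1).
Proof.
move=> mg g0; rewrite (_ : (fun _ => _) = fun w => expR (- ln (g w))); last first.
  by apply/funext => w; rewrite expRN lnK // posrE.
by apply: measurableT_comp => //; apply: measurable_funN; apply: measurableT_comp.
Qed.

(** Both ends of the interval move, the lower one with the parameter. Putting the interval into the
    integrand as an indicator leaves a section integral of a nonnegative jointly measurable
    function, to which Tonelli applies. *)
Lemma measurable_cumul (f : S * R -> R) (tau : S -> R) :
  measurable_fun setT f -> (forall p, 0 <= f p) -> measurable_fun setT tau ->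
  measurable_fun setT (fun p : S * R => cumul (fun r => f (p.1, r)) (tau p.1) p.2).
Proof.
move=> mf f0 mtau.
pose h (q : (S * R) * R) : \bar R :=
  (if (tau q.1.1 <= q.2) && (q.2 <= q.1.2) then f (q.1.1, q.2) else 0)%:E.
have mh : measurable_fun setT h.
  apply/measurable_EFinP; apply: measurable_fun_ifT => //.
    apply: measurable_and.
      apply: measurable_fun_ler => //; apply: measurableT_comp => //.
      by apply: measurableT_comp.
    by apply: measurable_fun_ler => //; apply: measurableT_comp.
  apply: measurableT_comp => //; apply: measurable_fun_pair => //.
  by apply: measurableT_comp.
rewrite (_ : (fun _ => _) = fine \o fubini_F mu h).
  apply: measurableT_comp => //; apply: measurable_fun_fubini_tonelli_F => //.
  by move=> q; rewrite /h lee_fin; case: ifP.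
apply/funext => -[w t] /=; rewrite /cumul /Rintegral /fubini_F.
rewrite integral_mkcond; congr fine; apply: eq_integral => r _.
by rewrite /h patchE mem_setE in_itv /=; case: ifP.
Qed.

End measurable_parameter.

Section exponential_integral.
Context {R : realType}.
Local Notation mu := (@lebesgue_measure R).

(** The factor 1/b gained by integrating the weight exp(b r) is what makes the fixed-point map a
    contraction for large b. *)
Lemma Rintegral_expR_le (b a t : R) : 0 < b -> a <= t ->
  \int[mu]_(r in `[a, t]) expR (b * r) <= expR (b * t) / b.
Proof.
move=> b0; rewrite le_eqVlt => /orP[/eqP ->|at_].
  by rewrite set_itv1 Rintegral_set1 divr_ge0 // ?expR_ge0 // ltW.
have db (x : R) : is_derive x 1 (fun r => expR (b * r) / b) (expR (b * x)).
  apply: is_derive_eq; rewrite /GRing.scale /= mulr0 add0r mulr1 mulrC -mulrA.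
  by rewrite divff ?mulr1 // gt_eqF.
have cb : continuous (fun r : R => expR (b * r)).
  move=> x; apply: differentiable_continuous; exact/derivable1_diffP.
have cb' : continuous (fun r : R => expR (b * r) / b).
  move=> x; apply: differentiable_continuous; exact/derivable1_diffP.
rewrite /Rintegral (@continuous_FTC2 _ _ (fun r => expR (b * r) / b)) //=.
- by rewrite lerBlDr lerDl divr_ge0 // ?expR_ge0 // ltW.
- exact: continuous_subspaceT.
- split => //.
  + by apply: cvg_at_right_filter; apply: cb'.
  + by apply: cvg_at_left_filter; apply: cb'.
- by move=> x _; rewrite derive1E; case: (db x).
Qed.

End exponential_integral.

(** * Estimates for expectations, quotients and exponentials *)

Section bounded_expectation.
Context {d : measure_display} {T : measurableType d} {R : realType}.
Variable P : probability T R.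
Implicit Types f g h : T -> R.

Lemma bounded_integrable f M : measurable_fun setT f ->
  (forall w, `|f w| <= M) -> P.-integrable setT (EFin \o f).
Proof.
move=> mf fM; apply: measurable_bounded_integrable => //.
  by rewrite [X in (X < _)%E](_ : _ = 1%E) ?ltry //; exact: probability_setT.
exists M; split; first by rewrite num_real.
by move=> N MN r _; apply: (le_trans (fM r)); exact: ltW.
Qed.

Lemma le_expectation f g M N : measurable_fun setT f -> measurable_fun setT g ->
  (forall w, `|f w| <= M) -> (forall w, `|g w| <= N) ->
  (forall w, f w <= g w) -> \int[P]_w f w <= \int[P]_w g w.
Proof.
move=> mf mg fM gN fg; apply: le_Rintegral => //.
  exact: bounded_integrable mf fM.
exact: bounded_integrable mg gN.
Qed.

Lemma expectationZ f M (c : R) : measurable_fun setT f ->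
  (forall w, `|f w| <= M) -> \int[P]_w (c * f w) = c * \int[P]_w f w.
Proof. by move=> mf fM; apply: RintegralZl => //; exact: bounded_integrable mf fM. Qed.

Lemma dist_expectation f g h M : measurable_fun setT f -> measurable_fun setT g ->
  measurable_fun setT h ->
  (forall w, `|f w| <= M) -> (forall w, `|g w| <= M) -> (forall w, h w <= M) ->
  (forall w, `|f w - g w| <= h w) ->
  `|\int[P]_w f w - \int[P]_w g w| <= \int[P]_w h w.
Proof.
move=> mf mg mh fM gM hM fgh.
have If := bounded_integrable mf fM; have Ig := bounded_integrable mg gM.
rewrite -RintegralB //.
have mfg : measurable_fun setT (fun w => f w - g w) by apply: measurable_funB.
have bfg w : `|f w - g w| <= M by apply: le_trans (fgh w) (hM w).
have Ifg := bounded_integrable mfg bfg.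
apply: (le_trans (le_normr_Rintegral _ Ifg)) => //.
apply: (le_expectation (M := M) (N := M)) => //; first exact: measurableT_comp.
- by move=> w; rewrite normr_id.
- by move=> w; rewrite ger0_norm // (le_trans _ (fgh w)).
Qed.

End bounded_expectation.

Lemma clip_dist {R : realType} (L U x y : R) :
  `|Num.max L (Num.min U x) - Num.max L (Num.min U y)| <= `|x - y|.
Proof.
have dmax a b : `|Num.max L a - Num.max L b| <= `|a - b|.
  have := ler_norm (a - b); have := ler_norm (b - a); rewrite (distrC b a).
  by case: (leP L a) => ?; case: (leP L b) => ?; rewrite ler_norml; set z := `|_|; lra.
apply: le_trans (dmax _ _) _.
have := ler_norm (x - y); have := ler_norm (y - x); rewrite (distrC y x).
by case: (leP U x) => ?; case: (leP U y) => ?; rewrite ler_norml; set z := `|_|; lra.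
Qed.

(** Here [m] plays the role of P(tau <= t). The differences of numerators and of denominators are
    proportional to [m], and [d'] is at least [k * m], so [m] cancels. If [m = 0], both quotients
    are 0, because division by 0 gives 0. *)
Lemma ratio_dist {R : realFieldType} (U D m n d n' d' k : R) :
  0 < k -> k * m <= d' -> 0 <= d -> 0 <= n <= U * d ->
  0 <= D -> 0 <= m -> 0 <= U ->
  `|d - d'| <= D * m -> `|n - n'| <= U * (D * m) -> (m = 0 -> d = 0 /\ d' = 0) ->
  `|n / d - n' / d'| <= 2 * U * D / k.
Proof.
move=> k0 kd d0 /andP[n0 nd] D0 m0 U0 dd nn' mz.
have rhs0 : 0 <= 2 * U * D / k by rewrite !mulr_ge0 // invr_ge0 ltW.
have [/eqP m_0|m_neq0] := boolP (m == 0).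
  by have [-> ->] := mz m_0; rewrite invr0 !mulr0 subrr normr0.
have m_gt0 : 0 < m by rewrite lt_neqAle eq_sym m_neq0.
have d'0 : 0 < d' by apply: lt_le_trans kd; rewrite mulr_gt0.
have dk : m / d' <= k^-1 by rewrite ler_pdivrMr // mulrC ler_pdivlMr // mulrC.
have nd' : 0 <= n / d <= U.
  rewrite divr_ge0 //=; have [/eqP ->|dn0] := boolP (d == 0).
    by rewrite invr0 mulr0.
  by rewrite ler_pdivrMr // lt_neqAle eq_sym dn0.
(* In this form only [d'] has to be bounded from below, while [n / d] is at most [U]. The identity
   survives [d = 0], which forces [n = 0]. *)
have E : n / d - n' / d' = (n / d) * ((d' - d) / d') + (n - n') / d'.
  have [/eqP dz|dn0] := boolP (d == 0).
    have -> : n = 0 by apply/eqP; rewrite eq_le n0 andbT; move: nd; rewrite dz mulr0.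
    by rewrite !mul0r !sub0r add0r mulNr.
  by field; rewrite dn0 gt_eqF.
rewrite E; apply: (le_trans (ler_normD _ _)).
rewrite !normrM [`|d'^-1|]ger0_norm ?invr_ge0 ?(ltW d'0) //.
rewrite [`|n|]ger0_norm // [`|d^-1|]ger0_norm ?invr_ge0 //.
have id' : 0 <= d'^-1 by rewrite invr_ge0 ltW.
have A : n / d * (`|d' - d| / d') <= U * (D * k^-1).
  have /andP[a b] := nd'; apply: ler_pM => //; first by rewrite mulr_ge0.
  apply: (le_trans (y := D * m / d')); first by rewrite ler_wpM2r // distrC.
  by rewrite -mulrA ler_wpM2l.
have B : `|n - n'| / d' <= U * (D * k^-1).
  apply: (le_trans (y := U * (D * m) / d')); first by rewrite ler_wpM2r.
  by rewrite -!mulrA ler_wpM2l // ler_wpM2l.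
apply: (le_trans (lerD A B)).
by rewrite le_eqVlt; apply/orP; left; apply/eqP; ring.
Qed.

(** For a <= b factor out exp(- a) <= 1 and apply 1 + x <= exp(x) at x = - (b - a). *)
Lemma expRN_dist {R : realType} (a b : R) : 0 <= a -> 0 <= b ->
  `|expR (- a) - expR (- b)| <= `|a - b|.
Proof.
wlog ab : a b / a <= b => [hw a0 b0|a0 b0].
  case: (leP a b) => [ab|/ltW ba]; first exact: hw.
  by rewrite distrC (distrC a); apply: hw.
rewrite ger0_norm ?subr_ge0 ?ler_expR ?lerN2 // distrC ger0_norm ?subr_ge0 //.
have -> : expR (- b) = expR (- a) * expR (- (b - a)).
  by rewrite -expRD; congr expR; ring.
have h1 := expR_ge1Dx (- (b - a)).
have h2 : expR (- a) <= 1 by rewrite expR_le1 oppr_le0.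
have h3 := expR_ge0 (- a).
rewrite -[X in X - _]mulr1 -mulrBr.
apply: (le_trans (y := expR (- a) * (b - a))).
  by apply: ler_wpM2l => //; lra.
by rewrite ler_piMl // subr_ge0.
Qed.

(** * The fixed-point equation for one level of the counting process *)

Section picard.
Context {d : measure_display} {T : measurableType d} {R : realType}.
Variables (P : probability T R) (e : T * R -> R) (lam : R -> R) (tau : T -> R).
Variables (L U : R).
Local Notation mu := (@lebesgue_measure R).

Definition rate (g : R -> R) (p : T * R) := e p * lam p.2 / g p.2.

Definition survival g (p : T * R) :=
  (tau p.1 <= p.2)%R%:R * expR (- cumul (fun r => rate g (p.1, r)) (tau p.1) p.2).

(** Clipping keeps the values in [L, U] even where the denominator vanishes and the quotient is 0 by
    convention. At a fixed point it is inactive wherever the denominator is positive. *)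
Definition mimicking_map (g : R -> R) (t : R) :=
  Num.max L (Num.min U
    (\int[P]_w (e (w, t) * survival g (w, t)) / \int[P]_w survival g (w, t))).

Definition admissible (g : R -> R) :=
  measurable_fun setT g /\ forall t, L <= g t <= U.

Hypotheses (L_gt0 : 0 < L) (L_le_U : L <= U).
Hypotheses (me : measurable_fun setT e) (eLU : forall p, L <= e p <= U).
Hypotheses (mlam : measurable_fun setT lam) (lamLU : forall t, L <= lam t <= U).

Let U_gt0 : 0 < U. Proof. exact: lt_le_trans L_le_U. Qed.

Lemma rate_bounds g p : admissible g -> L * L / U <= rate g p <= U * U / L.
Proof.
move=> [_ /(_ p.2) /andP[gL gU]]; rewrite /rate.
have /andP[eL eU] := eLU p; have /andP[lL lU] := lamLU p.2.
have g0 : 0 < g p.2 by apply: lt_le_trans gL.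
have L0 := ltW L_gt0; apply/andP; split.
- apply: ler_pM => //; rewrite ?mulr_ge0 ?invr_ge0 ?(ltW U_gt0) //.
    by apply: ler_pM.
  by rewrite lef_pV2.
- apply: ler_pM => //; rewrite ?mulr_ge0 ?invr_ge0 ?(ltW g0) //;
    rewrite ?(le_trans L0) //.
    by apply: ler_pM => //; rewrite ?(le_trans L0).
  by rewrite lef_pV2.
Qed.

Lemma rate_ge0 g p : admissible g -> 0 <= rate g p <= U * U / L.
Proof.
move=> /(rate_bounds p) /andP[cr ->]; rewrite (le_trans _ cr) //.
by rewrite divr_ge0 ?mulr_ge0 // ltW.
Qed.

Lemma measurable_rate g : admissible g -> measurable_fun setT (rate g).
Proof.
move=> [mg gLU]; apply: measurable_funM.
  by apply: measurable_funM => //; apply: measurableT_comp.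
apply: (measurableT_comp (f := fun t => (g t)^-1)) => //.
by apply: measurable_inv_pos => // t; have /andP[+ _] := gLU t; exact: lt_le_trans.
Qed.

Let mrate1 g w : admissible g -> measurable_fun setT (fun r => rate g (w, r)).
Proof. by move=> /measurable_rate mr; apply: measurableT_comp. Qed.

Hypotheses (mtau : measurable_fun setT tau) (tau_ge0 : forall w, 0 <= tau w).

Lemma survival_bounds g p : admissible g -> 0 <= survival g p <= (tau p.1 <= p.2)%R%:R.
Proof.
move=> Ag; rewrite /survival mulr_ge0 ?expR_ge0 //= ler_piMr // expR_le1 oppr_le0.
by apply: cumul_ge0 => r; apply: rate_ge0.
Qed.

Lemma measurable_survival g : admissible g -> measurable_fun setT (survival g).
Proof.
move=> Ag; apply: measurable_funM.
  apply: measurable_natr; apply: measurable_fun_ler => //.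
  by apply: measurableT_comp.
apply: measurableT_comp => //; apply: measurable_funN.
apply: measurable_cumul => //; first exact: measurable_rate.
by move=> p; have /andP[] := rate_ge0 p Ag.
Qed.

Lemma measurable_expectation (h : T * R -> R) : measurable_fun setT h ->
  (forall p, 0 <= h p) -> measurable_fun setT (fun t => \int[P]_w h (w, t)).
Proof.
move=> mh h0; apply: (measurableT_comp (f := fine)) => //.
apply: (measurable_fun_fubini_tonelli_G (fun p => (h p)%:E)).
  exact/measurable_EFinP.
by move=> p; rewrite lee_fin.
Qed.

Lemma measurable_mimicking_map g : admissible g -> measurable_fun setT (mimicking_map g).
Proof.
move=> Ag; apply: measurable_maxr => //; apply: measurable_minr => //.
have ms := measurable_survival Ag.
have s0 p : 0 <= survival g p by have /andP[] := survival_bounds p Ag.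
set n := fun t => \int[P]_w (e (w, t) * survival g (w, t)).
set m := fun t => \int[P]_w survival g (w, t).
have mn : measurable_fun setT n.
  apply: (measurable_expectation (h := fun p => e p * survival g p)); first exact: measurable_funM.
  by move=> p; rewrite mulr_ge0 // (le_trans (ltW L_gt0)) //; have /andP[] := eLU p.
have mm : measurable_fun setT m by exact: measurable_expectation.
have m0 t : 0 <= m t by apply: Rintegral_ge0.
(* Only inverses of positive functions are known to be measurable; (m t)^-1 = 0 when m t = 0. *)
rewrite (_ : (fun t => _) = fun t => n t * ((0 < m t)%R%:R * (if 0 < m t then m t else 1)^-1)).
  apply: measurable_funM => //; apply: measurable_funM.
    by apply: measurable_natr; apply: measurable_fun_ltr.
  apply: measurable_inv_pos; last by move=> t; case: ifP.
  by apply: measurable_fun_ifT => //; apply: measurable_fun_ltr.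
apply/funext => t; rewrite -/(n t) -/(m t); case: ltP; first by rewrite mul1r.
by move=> mt; have -> : m t = 0; [apply/eqP; rewrite eq_le mt m0 | rewrite invr0 mul0r].
Qed.

Lemma admissible_mimicking_map g : admissible g -> admissible (mimicking_map g).
Proof.
move=> Ag; split; first exact: measurable_mimicking_map.
by move=> t; rewrite /mimicking_map le_max lexx /= ge_max L_le_U ge_min lexx.
Qed.

(** One has 1/a - 1/b = (b - a) / (a b), and both values of the functions are at least L. *)
Lemma rate_dist g g' p : admissible g -> admissible g' ->
  `|rate g p - rate g' p| <= (U * U / (L * L)) * `|g p.2 - g' p.2|.
Proof.
move=> [_ /(_ p.2) /andP[gL _]] [_ /(_ p.2) /andP[gL' _]]; rewrite /rate.
have /andP[eL eU] := eLU p; have /andP[lL lU] := lamLU p.2.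
set a := g p.2 in gL *; set b := g' p.2 in gL' *.
have a0 : 0 < a by apply: lt_le_trans gL.
have b0 : 0 < b by apply: lt_le_trans gL'.
have L0 := ltW L_gt0.
have -> : e p * lam p.2 / a - e p * lam p.2 / b = e p * lam p.2 / (a * b) * (b - a).
  by field; rewrite !gt_eqF.
rewrite normrM distrC ler_wpM2r // ger0_norm; last first.
  by rewrite divr_ge0 ?mulr_ge0 ?(le_trans L0) ?(ltW a0) ?(ltW b0).
apply: ler_pM; rewrite ?invr_ge0 ?mulr_ge0 ?(le_trans L0) //.
  by apply: ler_pM => //; rewrite ?(le_trans L0).
by rewrite lef_pV2 ?posrE ?mulr_gt0 //; apply: ler_pM.
Qed.

(** Since [tau] is nonnegative, only times in [0, t] enter, and integrating the weight brings the
    factor 1/b. *)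
Lemma cumul_dist g g' delta b w t : admissible g -> admissible g' -> 0 < b ->
  0 <= delta -> tau w <= t ->
  (forall r, 0 <= r <= t -> `|g r - g' r| <= delta * expR (b * r)) ->
  `|cumul (fun r => rate g (w, r)) (tau w) t
    - cumul (fun r => rate g' (w, r)) (tau w) t| <=
  U * U / (L * L) * delta * (expR (b * t) / b).
Proof.
move=> Ag Ag' b0 d0 tt gg'.
set K := U * U / (L * L).
have K0 : 0 <= K by rewrite divr_ge0 ?mulr_ge0 // ltW.
have Ig := cumul_integrable (mrate1 w Ag) (fun r => rate_ge0 (w, r) Ag) (tau w) t.
have Ig' := cumul_integrable (mrate1 w Ag') (fun r => rate_ge0 (w, r) Ag') (tau w) t.
have Iexp : mu.-integrable `[tau w, t] (EFin \o (fun r => expR (b * r))).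
  apply: continuous_compact_integrable; first exact: segment_compact.
  apply: continuous_subspaceT => x; apply: differentiable_continuous.
  exact/derivable1_diffP.
rewrite /cumul -RintegralB //.
have IB : mu.-integrable `[tau w, t] (EFin \o (fun r => rate g (w, r) - rate g' (w, r))).
  by have := integrableB _ Ig Ig'; apply.
apply: (le_trans (le_normr_Rintegral _ IB)) => //.
apply: (le_trans (y := \int[mu]_(r in `[tau w, t]) (K * delta * expR (b * r)))).
  apply: le_Rintegral => //.
  - exact: integrable_norm.
  - have := @integrableZl _ _ _ mu `[tau w, t] _ (K * delta) _ Iexp; exact.
  - move=> r /=; rewrite in_itv /= => /andP[tr rt].
    apply: (le_trans (rate_dist _ Ag Ag')) => /=.
    rewrite -/K -(mulrA K delta) ler_wpM2l //.
    by apply: gg'; rewrite rt (le_trans (tau_ge0 w)).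
rewrite RintegralZl // ler_wpM2l //; first exact: mulr_ge0.
exact: Rintegral_expR_le.
Qed.

(** Write K = U^2 / L^2 and C = U^2 / L. The quotient estimate yields 2 U K delta exp(b t) exp(C Tm)
    / b; this choice of b turns it into delta / 2 times exp(b t). *)
Definition growth Tm := 4 * U * (U * U / (L * L)) * expR (U * U / L * Tm).

Lemma growth_gt0 Tm : 0 < growth Tm.
Proof.
rewrite /growth; apply: mulr_gt0; last exact: expR_gt0.
have U0 := U_gt0.
apply: mulr_gt0; first by rewrite mulr_gt0 // ltr0n.
by apply: divr_gt0; apply: mulr_gt0.
Qed.

(** The two survival functions vanish off {tau <= t} and differ there by at most D, the bound on the
    cumulative rates. Their integrals therefore differ by at most D P(tau <= t), and the quotient
    estimate applies. Only the values of [g] and [g'] on [0, t] are used. *)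
Lemma mimicking_map_contraction g g' t Tm delta : admissible g -> admissible g' ->
  t <= Tm -> 0 <= delta ->
  (forall r, 0 <= r <= t -> `|g r - g' r| <= delta * expR (growth Tm * r)) ->
  `|mimicking_map g t - mimicking_map g' t| <= delta / 2 * expR (growth Tm * t).
Proof.
move=> Ag Ag' tT d0 gg'; apply: (le_trans (clip_dist _ _ _ _)).
set K := U * U / (L * L); set C := U * U / L; set b := growth Tm.
have K0 : 0 <= K by rewrite divr_ge0 ?mulr_ge0 // ltW.
have C0 : 0 <= C by rewrite divr_ge0 ?mulr_ge0 // ltW.
have b0 : 0 < b := growth_gt0 Tm.
set D := K * delta * (expR (b * t) / b).
have D0 : 0 <= D.
  by apply: mulr_ge0; [exact: mulr_ge0 | rewrite divr_ge0 ?expR_ge0 // ltW].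
(* Its expectation P(tau <= t) is the quantity that cancels between numerator and denominator. *)
set one := fun w => (tau w <= t)%R%:R : R.
have m1 : measurable_fun setT one.
  by apply: measurable_natr; apply: measurable_fun_ler.
have one01 (w : T) : 0 <= one w <= 1 by rewrite /one; case: (tau w <= t); rewrite ?lexx ?ler01.
have one_norm (w : T) : `|one w| <= 1.
  by rewrite ger0_norm; case/andP: (one01 w).
have ms h : admissible h -> measurable_fun setT (fun w => survival h (w, t)).
  by move=> /measurable_survival mh; apply: measurableT_comp.
have sh h w : admissible h -> 0 <= survival h (w, t) <= one w.
  by move=> Ah; apply: survival_bounds.
have s_norm h w : admissible h -> `|survival h (w, t)| <= 1.
  by move=> /sh => /(_ w)/andP[s0 s1]; rewrite ger0_norm // (le_trans s1) //; case/andP: (one01 w).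
have met : measurable_fun setT (fun w => e (w, t)) by apply: measurableT_comp.
have e0 w : 0 <= e (w, t) by apply: (le_trans (ltW L_gt0)); case/andP: (eLU (w, t)).
have eU w : e (w, t) <= U by case/andP: (eLU (w, t)).
have mes h : admissible h -> measurable_fun setT (fun w => e (w, t) * survival h (w, t)).
  by move=> Ah; apply: measurable_funM => //; exact: ms.
have es_norm h w : admissible h -> `|e (w, t) * survival h (w, t)| <= U.
  move=> Ah; rewrite normrM ger0_norm // -[leRHS]mulr1; apply: ler_pM => //.
  exact: s_norm.
have sdist w : `|survival g (w, t) - survival g' (w, t)| <= D * one w.
  rewrite /survival /= /one; case: (leP (tau w) t) => [tt|_] /=; last by rewrite mulr0n !mul0r mulr0 subrr normr0.
  rewrite mulr1n !mul1r mulr1; apply: (le_trans (expRN_dist _ _)).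
  - by apply: cumul_ge0 => r; apply: rate_ge0.
  - by apply: cumul_ge0 => r; apply: rate_ge0.
  - exact: cumul_dist.
(* This is the equation that determined [growth], with exp(- C Tm) as the lower bound for survival
   on {tau <= t}. *)
have -> : delta / 2 * expR (b * t) = 2 * U * D / expR (- (C * Tm)).
  rewrite expRN invrK /D [in X in _ = X](_ : b = 4 * U * K * expR (C * Tm)) //.
  have := expR_gt0 (C * Tm); set x := expR (C * Tm) => x0.
  have U0 := U_gt0; have K1 : 0 < K by rewrite divr_gt0 ?mulr_gt0.
  rewrite -/b; set z := expR _.
  by field; rewrite !gt_eqF.
apply: (ratio_dist (m := \int[P]_w one w)) => //.
- exact: expR_gt0.
- rewrite -(expectationZ P _ m1 one_norm).
  apply: (@le_expectation _ _ _ P _ _ (expR (- (C * Tm))) 1) => //.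
  + exact: measurable_funM.
  + exact: ms.
  + by move=> w; rewrite normrM ger0_norm ?expR_ge0 // ler_piMr ?expR_ge0.
  + by move=> w; exact: s_norm.
  + move=> w; rewrite /survival /one /=; case: (leP (tau w) t) => tt /=; last by rewrite mulr0n mulr0 mul0r.
    rewrite mulr1n mulr1 mul1r ler_expR lerN2.
    (* As [tau] is nonnegative, the elapsed time t - tau is at most Tm. *)
    apply: le_trans (cumul_le (mrate1 w Ag') _ tt) _ => [r|]; first exact: rate_ge0.
    by rewrite ler_wpM2l //; have := tau_ge0 w; lra.
- by apply: Rintegral_ge0 => w _; case/andP: (sh g w Ag).
- rewrite Rintegral_ge0 /=; last by move=> w _; rewrite mulr_ge0 //; case/andP: (sh g w Ag).
  rewrite -(@expectationZ _ _ _ P _ 1 U) //; first last.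
  + by move=> w; exact: s_norm.
  + exact: ms.
  apply: (@le_expectation _ _ _ P _ _ (U) (U)).
  + exact: mes.
  + by apply: measurable_funM => //; exact: ms.
  + by move=> w; exact: es_norm.
  + move=> w; rewrite normrM ger0_norm ?(ltW U_gt0) // ler_piMr ?(ltW U_gt0) //.
    exact: s_norm.
  + by move=> w; rewrite ler_wpM2r //; case/andP: (sh g w Ag).
- by apply: Rintegral_ge0 => w _; case/andP: (one01 w).
- exact: ltW U_gt0.
- rewrite -(expectationZ P D m1 one_norm).
  apply: (@dist_expectation _ _ _ P _ _ _ (Num.max 1 D)) => //.
  + exact: ms.
  + exact: ms.
  + exact: measurable_funM.
  + by move=> w; rewrite le_max s_norm.
  + by move=> w; rewrite le_max s_norm.
  + by move=> w; rewrite le_max; apply/orP; right; rewrite ler_piMr //; case/andP: (one01 w).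
- rewrite -(expectationZ P D m1 one_norm).
  rewrite -(@expectationZ _ _ _ P _ D U); first last.
  + by move=> w; rewrite normrM (ger0_norm D0) ler_piMr.
  + exact: measurable_funM.
  apply: (@dist_expectation _ _ _ P _ _ _ (Num.max U (U * D))).
  + exact: mes.
  + exact: mes.
  + by apply: measurable_funM => //; exact: measurable_funM.
  + by move=> w; rewrite le_max es_norm.
  + by move=> w; rewrite le_max es_norm.
  + move=> w; rewrite le_max; apply/orP; right; rewrite ler_wpM2l ?(ltW U_gt0) //.
    by rewrite ler_piMr //; case/andP: (one01 w).
  + move=> w; rewrite -mulrBr normrM ger0_norm //.
    by apply: ler_pM.
- have sm h : admissible h -> \int[P]_w one w = 0 -> \int[P]_w survival h (w, t) = 0.
    move=> Ah m0; apply/eqP; rewrite eq_le Rintegral_ge0 ?andbT; last first.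
      by move=> w _; case/andP: (sh h w Ah).
    rewrite -m0; apply: (@le_expectation _ _ _ P _ _ (1) (1)) => //.
    + exact: ms.
    + by move=> w; exact: s_norm.
    + by move=> w; case/andP: (sh h w Ah).
  by move=> m0; split; apply: sm.
Qed.

End picard.

(** * Convergence of the Picard iterates *)

Lemma geometric_small {R : realType} (M eps : R) : 0 < eps ->
  exists n, M / 2 ^+ n < eps.
Proof.
move=> e0; have h : (fun n => M * (2^-1) ^+ n : R) @ \oo --> (M * 0 : R).
  by apply: cvgMr; apply: cvg_expr; rewrite ger0_norm // invf_lt1 ?ltr1n.
rewrite mulr0 in h; have /cvgr0Pnorm_lt /(_ _ e0) [n _ /(_ n)] := h.
rewrite /= => /(_ (leqnn n)) hn; exists n; rewrite -exprVn.
by apply: le_lt_trans hn; exact: ler_norm.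
Qed.

Lemma cvg_geometric {R : realType} (u : nat -> R) (M : R) :
  (forall n k, `|u (n + k)%N - u n| <= M / 2 ^+ n) ->
  cvgn u /\ forall n, `|limn u - u n| <= M / 2 ^+ n.
Proof.
move=> uM.
have cu : cvgn u.
  apply/cauchy_cvgP; apply: cauchy_exP => eps e0.
  have [n nM] := geometric_small M e0.
  exists (u n); exists n => // m /= nm.
  rewrite /ball /= distrC (le_lt_trans _ nM) // -(subnKC nm); exact: uM.
split=> // n.
have h : (fun k => `|u (k + n)%N - u n|) @ \oo --> `|limn u - u n|.
  by apply: cvg_norm; apply: cvgB; [rewrite cvg_shiftn | exact: cvg_cst].
rewrite -(cvg_lim _ h) //; apply: limr_le; first by apply/cvg_ex; eexists; exact: h.
by apply: nearW => k; rewrite addnC.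
Qed.

Section picard_limit.
Context {d : measure_display} {T : measurableType d} {R : realType}.
Variables (P : probability T R) (e : T * R -> R) (lam : R -> R) (tau : T -> R).
Variables (L U : R).

Definition picard n : R -> R := iter n (mimicking_map P e lam tau L U) (cst L).

Definition mimicking_rate (t : R) : R := limn (picard ^~ t).

Hypotheses (L_gt0 : 0 < L) (L_le_U : L <= U).
Hypotheses (me : measurable_fun setT e) (eLU : forall p, L <= e p <= U).
Hypotheses (mlam : measurable_fun setT lam) (lamLU : forall t, L <= lam t <= U).
Hypotheses (mtau : measurable_fun setT tau) (tau_ge0 : forall w, 0 <= tau w).

Local Notation growth := (growth L U).

Lemma admissible_picard n : admissible L U (picard n).
Proof.
elim: n => [|n IH]; last exact: admissible_mimicking_map.
by split => [|t]; [exact: measurable_cst | rewrite /= lexx].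
Qed.

Let U_gt0 : 0 < U. Proof. exact: lt_le_trans L_le_U. Qed.

(** At n = 0 two values in [L, U] differ by at most U, and the weight is at least 1 because t is
    nonnegative; each application of the map halves the bound. *)
Lemma picard_dist n k t Tm : 0 <= t <= Tm ->
  `|picard (n + k) t - picard n t| <= U / 2 ^+ n * expR (growth Tm * t).
Proof.
elim: n k t => [|n IH] k t /andP[t0 tT].
  have [_ /(_ t) /andP[a b]] := admissible_picard k.
  have U0 := U_gt0; rewrite /= expr0 divr1 ger0_norm ?subr_ge0 //.
  apply: (le_trans (y := U)); first by move: (L_gt0); lra.
  rewrite ler_peMr ?(ltW U_gt0) // -expR0 ler_expR mulr_ge0 //.
  by rewrite ltW // growth_gt0.
rewrite addSn.
have -> : U / 2 ^+ n.+1 * expR (growth Tm * t) =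
  U / 2 ^+ n / 2 * expR (growth Tm * t) by rewrite exprS invfM; ring.
apply: mimicking_map_contraction => //.
- exact: admissible_picard.
- exact: admissible_picard.
- by rewrite divr_ge0 ?exprn_ge0 // ltW.
- by move=> r /andP[r0 rt]; apply: IH; rewrite r0 (le_trans rt).
Qed.

(** After one more application of the map the sign of t no longer matters, since the map at t only
    looks at the iterates on [0, t]. The limit therefore exists at negative times too, as
    [admissible] requires. *)
Lemma picard_distS n k t Tm : t <= Tm ->
  `|picard (n + k).+1 t - picard n.+1 t| <= U / 2 ^+ n * expR (growth Tm * t).
Proof.
move=> tT.
apply: (le_trans (y := U / 2 ^+ n / 2 * expR (growth Tm * t))).
  apply: mimicking_map_contraction => //.
  - exact: admissible_picard.
  - exact: admissible_picard.
  - by rewrite divr_ge0 ?exprn_ge0 // ltW.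
  - by move=> r /andP[r0 rt]; apply: picard_dist; rewrite r0 (le_trans rt).
rewrite ler_wpM2r ?expR_ge0 // ler_pdivrMr ?ltr0n // ler_peMr ?ler1n //.
by rewrite divr_ge0 ?exprn_ge0 // ltW.
Qed.

Lemma picard_cvg t : picard ^~ t @ \oo --> mimicking_rate t.
Proof.
rewrite -(cvg_shiftn 1) /=.
(* Convergence is needed pointwise only, so the horizon may depend on t; [|t|] is one that bounds
   t. *)
have [] := @cvg_geometric _ (fun n => picard n.+1 t) (U * expR (growth `|t| * t)).
  move=> n k; rewrite mulrAC; apply: picard_distS; exact: ler_norm.
move=> cu _; rewrite /mimicking_rate.
have -> : limn (picard ^~ t) = limn (fun n => picard n.+1 t).
  by apply: cvg_lim => //; rewrite -cvg_shiftS.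
by under eq_fun do rewrite addn1.
Qed.

Lemma mimicking_rate_dist n t Tm : t <= Tm ->
  `|mimicking_rate t - picard n.+1 t| <= U / 2 ^+ n * expR (growth Tm * t).
Proof.
move=> tT.
have [cu] := @cvg_geometric _ (fun n => picard n.+1 t) (U * expR (growth Tm * t))
  (fun n k => ltac:(rewrite mulrAC; exact: picard_distS)).
move=> /(_ n); rewrite mulrAC; congr (`|_ - _| <= _).
by apply: cvg_lim => //; have := @picard_cvg t; rewrite -cvg_shiftS.
Qed.

Lemma admissible_mimicking_rate : admissible L U mimicking_rate.
Proof.
split.
  apply: (@measurable_fun_cvg _ _ _ setT picard).
    by move=> n; have [] := admissible_picard n.
  by move=> t _; exact: picard_cvg.
move=> t; have cu : cvgn (picard ^~ t) by apply/cvg_ex; eexists; exact: picard_cvg.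
rewrite limr_ge ?limr_le //; apply: nearW => n;
  by have [_ /(_ t) /andP[]] := admissible_picard n.
Qed.

(** By contraction, the image of the limit is as close to iterate n + 2 as the limit is to iterate n
    + 1, up to a factor 1/2. Both sides are thus within O(2^-n) of the same iterate. *)
Lemma mimicking_rate_fix t : mimicking_map P e lam tau L U mimicking_rate t = mimicking_rate t.
Proof.
apply/eqP; rewrite -subr_eq0 -normr_le0; apply/ler_addgt0Pr => eps e0.
rewrite add0r; have U0 := ltW U_gt0.
set E := expR (growth `|t| * t).
have [n nM] := geometric_small (2 * U * E) e0.
apply: ltW; apply: le_lt_trans nM.
have tT := ler_norm t.
have h1 : `|mimicking_map P e lam tau L U mimicking_rate t - picard n.+2 t| <= U / 2 ^+ n / 2 * E.
  apply: mimicking_map_contraction => //.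
  - exact: admissible_mimicking_rate.
  - exact: (admissible_picard n.+1).
  - by rewrite divr_ge0 ?exprn_ge0.
  - by move=> r /andP[r0 rt]; apply: mimicking_rate_dist; rewrite (le_trans rt).
have h2 := @mimicking_rate_dist n.+1 t `|t| tT.
rewrite exprS invfM (mulrC 2^-1) !mulrA -/E in h2.
rewrite [X in `|X|](_ : _ = (mimicking_map P e lam tau L U mimicking_rate t - picard n.+2 t)
   - (mimicking_rate t - picard n.+2 t)); last by rewrite opprB addrA subrK.
apply: (le_trans (ler_normB _ _)); apply: (le_trans (lerD h1 h2)).
have E0 : 0 <= U / 2 ^+ n * E by rewrite mulr_ge0 ?expR_ge0 ?divr_ge0 ?exprn_ge0.
have -> : 2 * U * E / 2 ^+ n = 2 * (U / 2 ^+ n * E) by ring.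
have -> : U / 2 ^+ n / 2 * E = (U / 2 ^+ n * E) / 2 by ring.
lra.
Qed.

(* Since survival is the conditional probability of tau <= t < tau' given the past
   of tau, this says E[e_t; tau <= t < tau'] = g(t) P(tau <= t < tau'). *)
Lemma mimicking_rate_balance t :
  \int[P]_w (e (w, t) * survival e lam tau mimicking_rate (w, t)) =
  mimicking_rate t * \int[P]_w survival e lam tau mimicking_rate (w, t).
Proof.
have := mimicking_rate_fix t; rewrite /mimicking_map.
have Ag := admissible_mimicking_rate.
set s := fun w => survival e lam tau mimicking_rate (w, t).
have ms : measurable_fun setT s.
  have msv := measurable_survival L_gt0 L_le_U me eLU mlam lamLU mtau Ag.
  exact: measurableT_comp.
have s01 w : 0 <= s w <= 1.
  have /andP[a b] := survival_bounds tau L_gt0 L_le_U eLU lamLU (w, t) Ag.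
  apply/andP; split => //; apply: (le_trans b) => /=.
  by case: (tau w <= t); rewrite ?lexx ?ler01.
have s_norm w : `|s w| <= 1.
  by have /andP[a b] := s01 w; rewrite ger0_norm.
have met : measurable_fun setT (fun w => e (w, t)) by apply: measurableT_comp.
have e0 w : 0 <= e (w, t) by apply: (le_trans (ltW L_gt0)); case/andP: (eLU (w, t)).
have es w : `|e (w, t) * s w| <= U.
  rewrite normrM ger0_norm // -[leRHS]mulr1; apply: ler_pM => //.
  by case/andP: (eLU (w, t)).
have mes : measurable_fun setT (fun w => e (w, t) * s w) by apply: measurable_funM.
have nU : \int[P]_w (e (w, t) * s w) <= U * \int[P]_w s w.
  rewrite -(@expectationZ _ _ _ P _ 1 U) //.
  apply: (@le_expectation _ _ _ P _ _ U U) => //; first exact: measurable_funM.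
    by move=> w; rewrite normrM (ger0_norm (ltW U_gt0)) ler_piMr // ltW.
  by move=> w; rewrite ler_wpM2r //; [case/andP: (s01 w) | case/andP: (eLU (w, t))].
have nL : L * \int[P]_w s w <= \int[P]_w (e (w, t) * s w).
  rewrite -(@expectationZ _ _ _ P _ 1 L) //.
  apply: (@le_expectation _ _ _ P _ _ U U) => //; first exact: measurable_funM.
    move=> w; rewrite normrM (ger0_norm (ltW L_gt0)) -[leRHS]mulr1.
    by apply: ler_pM => //; exact: ltW.
  by move=> w; rewrite ler_wpM2r //; [case/andP: (s01 w) | case/andP: (eLU (w, t))].
rewrite -/s; move: nU nL; set n := \int[P]_w (_ * _); set m := \int[P]_w _ => nU nL.
have m0 : 0 <= m by apply: Rintegral_ge0 => w _; case/andP: (s01 w).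
(* If the level has probability 0, the numerator is squeezed to 0 as well; otherwise the quotient
   lies in [L, U] and the clipping disappears. *)
have [/eqP m_0|m_neq0] := boolP (m == 0).
  by move: nU nL; rewrite m_0 !mulr0 => n1 n2 _; apply/eqP; rewrite eq_le n1 n2.
have m_gt0 : 0 < m by rewrite lt_neqAle eq_sym m_neq0.
rewrite min_r; last by rewrite ler_pdivrMr.
rewrite max_r; last by rewrite ler_pdivlMr.
by move=> <-; rewrite divfK.
Qed.

End picard_limit.

(** * Freezing the past *)

Section freezing.
Context {d d1 d2 : measure_display} {T : measurableType d} {S : measurableType d1}
  {S' : measurableType d2} {R : realType}.
Variables (P : probability T R) (X : {mfun T >-> S}) (V : {mfun T >-> S'}).
Hypothesis indep : forall A B, measurable A -> measurable B ->
  (P (X @^-1` A `&` V @^-1` B) = P (X @^-1` A) * P (V @^-1` B))%E.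

(** Independence says that the joint law of [X] and [V] is the product of their laws; Tonelli does
    the rest. *)
Lemma freezing (f : S * S' -> \bar R) : measurable_fun setT f ->
  (forall p, 0 <= f p)%E ->
  (\int[P]_w f (X w, V w) = \int[P]_w \int[P]_v f (X w, V v))%E.
Proof.
move=> mf f0.
have mXV : (fun w => (X w, V w)) \in mfun.
  by rewrite inE /=; apply: measurable_fun_pair.
pose XV : {mfun T >-> (S * S')%type} := mfun_Sub mXV.
rewrite -(@ge0_integral_distribution _ _ _ _ _ P XV) //.
have E Z : measurable Z -> (distribution P X \x distribution P V)%E Z = distribution P XV Z.
  move=> mZ; exact: product_measure_unique.
rewrite (eq_measure_integral (distribution P X \x distribution P V)%E); last first.
  by move=> Z mZ _; apply/esym; exact: E.
rewrite fubini_tonelli1 // /fubini_F ge0_integral_distribution //.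
- apply: eq_integral => w _ /=; rewrite ge0_integral_distribution //.
  exact: measurableT_comp.
- exact: measurable_fun_fubini_tonelli_F.
- by move=> y; apply: integral_ge0 => z _.
Qed.

End freezing.

Section exponential_freezing.
Context {d d1 : measure_display} {T : measurableType d} {S : measurableType d1}
  {R : realType}.
Variables (P : probability T R) (X : {mfun T >-> S}) (V : {mfun T >-> R}).
Hypothesis indep : forall A B, measurable A -> measurable B ->
  (P (X @^-1` A `&` V @^-1` B) = P (X @^-1` A) * P (V @^-1` B))%E.
Hypothesis expV : exp1_distributed P V.
Local Notation mu := (@lebesgue_measure R).

Let expV_itv b : 0 <= b -> P [set w | 0 <= V w <= b] = (1 - expR (- b))%:E.
Proof.
move=> b0; have := expV (measurable_itv `[0, b]); rewrite (_ : _ @^-1` _ = [set w | 0 <= V w <= b]); last first.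
  by apply/seteqP; split => w /=; rewrite in_itv.
move=> ->; move: b0; rewrite le_eqVlt => /orP[/eqP <-|b0].
  by rewrite set_itv1 /exponential_prob integral_set1 oppr0 expR0 subrr.
by rewrite exponential_prob_itv0c // mulN1r.
Qed.

(** The law allows negative values on a null event, which is why [V] is truncated at 0 below. *)
Let expV_lt0 : P [set w | V w < 0] = 0%E.
Proof.
have := expV (measurable_itv `]-oo, 0[); rewrite (_ : _ @^-1` _ = [set w | V w < 0]); last first.
  by apply/seteqP; split => w /=; rewrite in_itv.
move=> ->; rewrite /exponential_prob integral0_eq // => x /=; rewrite in_itv /= => x0.
by rewrite lt0_exponential_pdf.
Qed.

Let mV_set (A : set R) : measurable A -> measurable (V @^-1` A).
Proof. by move=> mA; rewrite -[X in measurable X]setTI; exact: measurable_funPT. Qed.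

Lemma exp1_le b : 0 <= b -> P [set w | V w <= b] = (1 - expR (- b))%:E.
Proof.
move=> b0; rewrite -expV_itv // (_ : [set w | V w <= b] = V @^-1` `[0, b] `|` V @^-1` `]-oo, 0[).
  rewrite measureU0; [| exact: mV_set | exact: mV_set |].
    by congr (P _); apply/seteqP; split => w /=; rewrite in_itv.
  by rewrite -expV_lt0; congr (P _); apply/seteqP; split => w /=; rewrite in_itv.
apply/seteqP; split => w /=; rewrite !in_itv /=.
  by move=> wb; case: (leP 0 (V w)); [left | right].
by case=> [/andP[]//|V0]; apply: (le_trans (ltW V0)).
Qed.

Lemma exp1_gt b : 0 <= b -> P [set w | b < V w] = (expR (- b))%:E.
Proof.
move=> b0; rewrite (_ : [set w | b < V w] = ~` (V @^-1` `]-oo, b])).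
  rewrite probability_setC; last exact: mV_set.
  rewrite (_ : _ @^-1` _ = [set w | V w <= b]).
    by rewrite exp1_le // -EFinB; congr EFin; ring.
  by apply/seteqP; split => w /=; rewrite in_itv.
apply/seteqP; split => w /=; rewrite in_itv /=; first by rewrite ltNge => /negP.
by move=> /negP; rewrite -ltNge.
Qed.

Lemma exp1_gt0_ae : P [set w | V w <= 0] = 0%E.
Proof. by rewrite exp1_le // oppr0 expR0 subrr. Qed.

(** The layer-cake formula for a variable capped at [b], which prepares the use of Tonelli. *)
Lemma integral_lt_min (v b : R) : 0 <= b ->
  (\int[mu]_(x in `[0%R, b]) (x < v)%R%:R%:E = (Num.min (Num.max 0 v) b)%:E)%E.
Proof.
move=> b0; rewrite (_ : (fun x => _) = fun x => (\1_(`]-oo, v[ : set R) x)%:E); last first.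
  by apply/funext => x; rewrite indicE mem_setE in_itv.
rewrite integral_indic //=.
have [v0|v0] := leP v 0.
  rewrite (_ : _ `&` _ = set0); first by rewrite measure0 min_l.
  apply/seteqP; split => x //=; rewrite !in_itv /= => -[xv /andP[x0 _]].
  by move: (lt_le_trans xv v0); rewrite ltNge x0.
have [vb|bv] := ltP v b.
  rewrite (_ : _ `&` _ = `[0, v[%classic).
    by rewrite lebesgue_measure_itv /= lte_fin v0 oppr0 adde0.
  apply/seteqP; split => x /=; rewrite !in_itv /=; first by move=> [-> /andP[->]].
  by move=> /andP[x0 xv]; rewrite x0 xv; split=> //; rewrite (ltW (lt_trans xv vb)).
have [bv'|vb] := ltP b v.
  rewrite (_ : _ `&` _ = `[0, b]%classic).
    rewrite lebesgue_measure_itv /= lte_fin oppr0 adde0; case: ltP => // b_0.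
    by congr EFin; apply/eqP; rewrite eq_le b0 b_0.
  apply/seteqP; split => x /=; rewrite !in_itv /=; first by case.
  by move=> /andP[x0 xb]; rewrite x0 xb (le_lt_trans xb bv').
have -> : b = v by apply/eqP; rewrite eq_le bv vb.
rewrite (_ : _ `&` _ = `[0, v[%classic).
  by rewrite lebesgue_measure_itv /= lte_fin v0 oppr0 adde0.
apply/seteqP; split => x /=; rewrite !in_itv /=; first by move=> [-> /andP[->]].
by move=> /andP[x0 xv]; rewrite x0 xv (ltW xv).
Qed.

(** By the layer-cake formula the expectation is the integral over [0, b] of P(V > x) = exp(- x).
    For the unit exponential law this tail is also the density, so the result is P(V <= b). This
    unit hazard rate is the source of the compensator. *)
Lemma expectation_min_exp1 b : 0 <= b ->
  (\int[P]_w (Num.min (Num.max 0 (V w)) b)%:E = (1 - expR (- b))%:E)%E.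
Proof.
move=> b0; under eq_integral do rewrite -integral_lt_min //.
pose h (p : T * R) : \bar R := ((0 <= p.2 <= b) && (p.2 < V p.1))%R%:R%:E.
have mh : measurable_fun setT h.
  apply/measurable_EFinP; apply: measurable_natr; apply: measurable_and.
    by apply: measurable_and; apply: measurable_fun_ler => //; exact: measurable_cst.
  by apply: measurable_fun_ltr => //; apply: measurableT_comp.
transitivity (\int[P]_w \int[mu]_x h (w, x))%E.
  apply: eq_integral => w _; rewrite integral_mkcond; apply: eq_integral => x _.
  by rewrite /h patchE mem_setE in_itv /=; case: ifP.
rewrite fubini_tonelli //; last by move=> p; rewrite /h lee_fin.
transitivity (\int[mu]_(x in `[0%R, b]) (exponential_pdf 1 x)%:E)%E.
  rewrite [RHS]integral_mkcond; apply: eq_integral => x _.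
  rewrite patchE mem_setE in_itv /=; case: ifP => xb; last first.
    by apply: integral0_eq => w _; rewrite /h /= xb.
  have /andP[x0 _] := xb.
  rewrite exponential_pdfE // mul1r mulN1r -exp1_gt //.
  rewrite (_ : (fun w => _) = fun w => (\1_([set w | x < V w]) w)%:E); last first.
    by apply/funext => w; rewrite /h /= xb indicE mem_setE.
  rewrite integral_indic ?setIT //.
  by have := mV_set (measurable_itv `]x, +oo[); congr (measurable _);
    apply/seteqP; split => w /=; rewrite in_itv /= andbT.
rewrite -expV_itv //; have := expV (measurable_itv `[0, b]).
rewrite /exponential_prob => <-; congr (P _).
Qed.

Lemma freezing_gt (Z y : S -> R) : measurable_fun setT Z -> measurable_fun setT y ->
  (forall s, 0 <= Z s) -> (forall s, 0 <= y s) ->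
  (\int[P]_w (Z (X w) * (y (X w) < V w)%R%:R)%:E =
   \int[P]_w (Z (X w) * expR (- y (X w)))%:E)%E.
Proof.
move=> mZ my Z0 y0.
pose f (p : S * R) : \bar R := (Z p.1 * (y p.1 < p.2)%R%:R)%:E.
rewrite (freezing indep (f := f)) /f /=; first last.
- by move=> p; rewrite lee_fin mulr_ge0.
- apply/measurable_EFinP; apply: measurable_funM; first exact: measurableT_comp.
  by apply: measurable_natr; apply: measurable_fun_ltr => //; exact: measurableT_comp.
apply: eq_integral => w _; under eq_integral do rewrite EFinM.
have mlt : measurable [set v | y (X w) < V v].
  by have := mV_set (measurable_itv `]y (X w), +oo[); congr (measurable _);
    apply/seteqP; split => v /=; rewrite in_itv /= andbT.
rewrite (_ : (fun v => _) = fun v => ((Z (X w))%:E * (\1_[set v | y (X w) < V v] v)%:E)%E); last first.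
  by apply/funext => v; rewrite indicE mem_setE.
rewrite ge0_integralZl //; last by rewrite lee_fin.
  rewrite integral_indic // setIT EFinM; congr (_ * _)%E; exact: exp1_gt.
exact/measurable_EFinP/measurable_indic.
Qed.

(** Once [X] is frozen, both inner integrals equal Z (1 - exp(- y)). *)
Lemma freezing_min (Z y : S -> R) : measurable_fun setT Z -> measurable_fun setT y ->
  (forall s, 0 <= Z s) -> (forall s, 0 <= y s) ->
  (\int[P]_w (Z (X w) * (V w <= y (X w))%R%:R)%:E =
   \int[P]_w (Z (X w) * Num.min (Num.max 0 (V w)) (y (X w)))%:E)%E.
Proof.
move=> mZ my Z0 y0.
pose f (p : S * R) : \bar R := (Z p.1 * (p.2 <= y p.1)%R%:R)%:E.
pose g (p : S * R) : \bar R := (Z p.1 * Num.min (Num.max 0 p.2) (y p.1))%:E.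
have my' : measurable_fun setT (fun p : S * R => y p.1) by exact: measurableT_comp.
have mZ' : measurable_fun setT (fun p : S * R => Z p.1) by exact: measurableT_comp.
have min0 (v : R) s : 0 <= Num.min (Num.max 0 v) (y s).
  by rewrite le_min le_max lexx y0.
rewrite (freezing indep (f := f)) /f /=; first last.
- by move=> p; rewrite lee_fin mulr_ge0.
- apply/measurable_EFinP; apply: measurable_funM => //.
  by apply: measurable_natr; apply: measurable_fun_ler.
rewrite (freezing indep (f := g)) /g /=; first last.
- by move=> p; rewrite lee_fin mulr_ge0.
- apply/measurable_EFinP; apply: measurable_funM => //.
  by apply: measurable_minr => //; apply: measurable_maxr.
apply: eq_integral => w _; under eq_integral do rewrite EFinM.
under [RHS]eq_integral do rewrite EFinM.
have mle : measurable [set v | V v <= y (X w)].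
  by have := mV_set (measurable_itv `]-oo, y (X w)]); congr (measurable _);
    apply/seteqP; split => v /=; rewrite in_itv.
rewrite ge0_integralZl //; last by rewrite lee_fin.
  rewrite ge0_integralZl //; last by rewrite lee_fin.
  - rewrite expectation_min_exp1 //; congr (_ * _)%E.
    rewrite (_ : (fun v => _) = fun v => (\1_[set v | V v <= y (X w)] v)%:E); last first.
      by apply/funext => v; rewrite indicE mem_setE.
    by rewrite integral_indic // setIT; exact: exp1_le.
  - by apply/measurable_EFinP; apply: measurable_minr => //; apply: measurable_maxr.
  - by move=> v _; rewrite lee_fin min0.
apply/measurable_EFinP; apply: measurable_natr; exact: measurable_fun_ler.
Qed.

End exponential_freezing.

(** * Joint measurability and generation by pi-systems *)

Lemma measurable_nat_le {d : measure_display} {S : measurableType d} (f : S -> nat) :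
  (forall k, measurable [set x | (f x <= k)%N]) -> measurable_fun setT f.
Proof.
move=> mf _ B _; rewrite setTI.
rewrite (_ : f @^-1` B = \bigcup_(k in B) [set x | f x = k]).
  apply: bigcup_measurable => -[|k] _.
    by rewrite (_ : [set x | f x = 0%N] = [set x | (f x <= 0)%N]) //;
      apply/seteqP; split => x /=; rewrite leqn0 => /eqP.
  rewrite (_ : [set x | f x = k.+1] = [set x | (f x <= k.+1)%N] `\` [set x | (f x <= k)%N]).
    exact: measurableD.
  apply/seteqP; split => x /=; first by move=> ->; split => //; rewrite ltnn.
  by move=> [h1 /negP]; rewrite -ltnNge => h2; apply/eqP; rewrite eqn_leq h1 h2.
by apply/seteqP; split => [x fx|x [k Bk /= ->] //]; exists (f x).
Qed.

Lemma measurable_select {d d' : measure_display} {S : measurableType d}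
    {Y : measurableType d'} (g : nat -> S -> Y) (kappa : S -> nat) :
  (forall k, measurable_fun setT (g k)) -> measurable_fun setT kappa ->
  measurable_fun setT (fun x => g (kappa x) x).
Proof.
move=> mg mk _ B mB; rewrite setTI.
rewrite (_ : _ @^-1` B = \bigcup_k ((g k @^-1` B) `&` (kappa @^-1` [set k]))).
  apply: bigcupT_measurable => k; apply: measurableI.
    by rewrite -[X in measurable X]setTI; exact: mg.
  by rewrite -[X in measurable X]setTI; exact: mk.
apply/seteqP; split => [x Bx|x [k _ [/= Bk kk]]]; last by rewrite /= kk.
by exists (kappa x).
Qed.

Section left_continuous.
Context {d : measure_display} {S : measurableType d} {R : realType}.

(** One grid step is subtracted so that the grid point lies strictly to the left of every t > 0, as
    left limits demand; it stays at 0 when t lies in the first cell. *)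
Let kappa n (t : R) : nat := (Num.truncn (n.+1%:R * t)).-1.

Let measurable_kappa n : measurable_fun setT (kappa n).
Proof.
apply: measurable_nat_le => k.
rewrite (_ : [set x | _] = `]-oo, (k.+2%:R / n.+1%:R)[%classic) //.
apply/seteqP; split => t /=; rewrite in_itv /= /kappa -ltnS ltr_pdivlMr ?ltr0n //;
  rewrite mulrC -truncn_le_nat; case: (Num.truncn _) => //.
Qed.

Let kappa_cvg t : 0 < t -> (kappa n t)%:R / n.+1%:R @[n --> \oo] --> t^'-.
Proof.
move=> t0.
have lt_t n : (kappa n t)%:R / n.+1%:R < t.
  rewrite ltr_pdivrMr ?ltr0n // mulrC /kappa.
  have nt0 : 0 <= n.+1%:R * t by rewrite mulr_ge0 // ltW.
  have /andP[h _] := truncn_itv nt0.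
  case: (Num.truncn _) h => [|m] /= h; first by rewrite mulr_gt0 // ltr0n.
  by apply: lt_le_trans h; rewrite ltr_nat.
have ge_t n : t - 2 / n.+1%:R <= (kappa n t)%:R / n.+1%:R.
  rewrite lerBlDr -mulrDl.
  rewrite ler_pdivlMr ?ltr0n // mulrC /kappa.
  have := truncnS_gt (n.+1%:R * t); case: (Num.truncn _) => [|m] /= h.
    by move: h; set z := _ * t; lra.
  by rewrite -natrD addn2 ltW.
move=> A /= [e /= e0 Ae].
have h : (fun n => 2 / n.+1%:R : R) @ \oo --> (2 * 0 : R).
  by apply: cvgMr; exact: cvg_harmonic.
rewrite mulr0 in h; have /cvgr0Pnorm_lt /(_ _ e0) [N _ hN] := h.
exists N => // n Nn /=; apply: Ae; last exact: lt_t.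
have := hN n Nn; rewrite /= ger0_norm ?divr_ge0 // => he.
rewrite /ball /= ger0_norm; last by rewrite subr_ge0 ltW.
by apply: le_lt_trans he; have := ge_t n; rewrite lerBlDr -lerBlDl.
Qed.

(** Left continuity makes the process the pointwise limit of its values at grid points approaching t
    from the left, and each approximation takes countably many time values. *)
Lemma measurable_left_continuous (X : R -> S -> R) :
  (forall t, 0 <= t -> measurable_fun setT (X t)) -> left_continuous_paths X ->
  measurable_fun ([set: S] `*` (`[0, +oo[ : set R)) (fun p : S * R => X p.2 p.1).
Proof.
move=> mX lX.
apply: (@measurable_fun_cvg _ _ _ _
  (fun n (p : S * R) => X ((kappa n p.2)%:R / n.+1%:R) p.1)).
  move=> n; apply: measurable_funTS.
  apply: (@measurable_select _ _ (S * R)%type R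
    (fun k p => X (k%:R / n.+1%:R) p.1) (fun p => kappa n p.2)).
    by move=> k; apply: measurableT_comp => //; apply: mX; rewrite divr_ge0.
  exact: measurableT_comp.
move=> [w t] [_ /=]; rewrite in_itv /= andbT le_eqVlt => /orP[/eqP <-|t0].
  rewrite /kappa; under eq_fun do rewrite mulr0 truncn0 mul0r.
  exact: cvg_cst.
exact: (cvg_comp _ _ (kappa_cvg t0) (lX w t t0)).
Qed.

End left_continuous.

(** It suffices to treat the left-continuous adapted generators. Joint measurability is obtained for
    the sigma-algebra of [G] rather than the ambient one, so that the rates built from [eta] are
    known given every H_k. *)
Lemma measurable_predictable {d : measure_display} {T : measurableType d} {R : realType}
    (F : R -> set_system T) (G : set_system T) (eta : R -> T -> R) :
  (forall t, 0 <= t -> F t `<=` <<s G >>) -> predictable F eta ->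
  measurable_fun ([set: g_sigma_algebraType G] `*` (`[0, +oo[ : set R))
    (fun p : g_sigma_algebraType G * R => eta p.2 p.1).
Proof.
move=> FG eta_pred mD B mB.
set D := [set: _] `*` _ in mD *.
suff sub : predictable_sigma F `<=` [set A | measurable (A : set (g_sigma_algebraType G * R))].
  by apply: sub; apply: eta_pred; exists B.
apply: smallest_sub.
  split => //=; first by move=> A mA; apply: measurableD.
  by move=> A mA; exact: bigcupT_measurable.
move=> A [X [adX lX]] [C mC <-].
apply: (@measurable_left_continuous _ (g_sigma_algebraType G) R X) => //.
move=> t t0 _ C' mC'; apply: (FG t t0); apply: adX => //; exists C' => //.
Qed.

(** A -> P(A and C) and A -> P(A) P(C) are finite measures that agree on a pi-system containing the
    whole space. *)
Lemma independent_g_sigma {d : measure_display} {T : measurableType d} {R : realType}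
    (P : probability T R) (G : set_system T) (C : set T) :
  G `<=` measurable -> setI_closed G -> G setT -> measurable C ->
  (forall A, G A -> P (A `&` C) = (P A * P C)%E) ->
  forall A, <<s G >> A -> P (A `&` C) = (P A * P C)%E.
Proof.
move=> Gm GI GT mC GC A sA.
have PC0 : 0 <= fine (P C) by exact: fine_ge0.
pose m2 := mscale (NngNum PC0) P.
have m2E B : m2 B = (P B * P C)%E by rewrite /m2 /mscale /= fineK ?fin_num_measure // muleC.
rewrite -m2E.
have := @g_sigma_algebra_measure_unique _ R T G Gm (fun=> setT) (fun=> GT) _
  (mrestr P mC) m2 GI _ _ A sA; apply.
- by apply/seteqP; split => // x _; exists 0%N.
- by move=> B GB; transitivity (P B * P C)%E; [exact: GC | exact/esym/m2E].
- by move=> k; rewrite /mrestr ltey_eq fin_num_measure //; apply: measurableI.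
Qed.

(** * The past of the k-th jump *)

Section history.
Context {d : measure_display} {T : measurableType d} {R : realType}.
Variables (P : probability T R) (F : R -> set_system T) (E : nat -> {RV P >-> R}).

Definition past_values k (B : nat -> set R) :=
  \bigcap_(j in [set` iota 0 k]) (E j @^-1` B j).

(* A pi-system generating sigma(F_oo, E_0, ..., E_{k-1}). *)
Definition history k : set_system T :=
  [set D | exists A B, [/\ filtration_infty F A, forall j, measurable (B j)
                         & D = A `&` past_values k B]].

Hypothesis usualF : usual_conditions P F.

Lemma sub_filtration_infty t : 0 <= t -> F t `<=` filtration_infty F.
Proof.
by move=> t0 A FA; apply: sub_sigma_algebra; exists t => //=; rewrite in_itv /= t0.
Qed.

Lemma filtration_infty_measurable : filtration_infty F `<=` measurable.
Proof.
have [[_ Fm _] _ _] := usualF.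
apply: smallest_sub; first exact: sigma_algebra_measurable.
by move=> A [t /=]; rewrite in_itv /= andbT => t0; exact: Fm.
Qed.

Lemma filtration_inftyI A B :
  filtration_infty F A -> filtration_infty F B -> filtration_infty F (A `&` B).
Proof. exact: (@measurableI _ (g_sigma_algebraType (\bigcup_(t in `[0, +oo[) F t))). Qed.

Lemma past_valuesP k B w : past_values k B w <-> forall j, (j < k)%N -> B j (E j w).
Proof.
have mem j : [set` iota 0 k] j = (j < k)%N :> Prop by rewrite /= mem_iota.
by split=> h j jk; apply: h; rewrite ?mem // -mem.
Qed.

Lemma past_valuesT k : past_values k (fun=> setT) = setT.
Proof. by apply/seteqP; split. Qed.

Lemma past_valuesS k B : past_values k.+1 B = past_values k B `&` E k @^-1` B k.
Proof.
apply/seteqP; split => w; rewrite /= !past_valuesP.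
  by move=> h; split=> [j /ltnW|]; [exact: h | exact: h].
move=> [h hk] j; rewrite ltnS leq_eqVlt => /orP[/eqP ->//|]; exact: h.
Qed.

Lemma sub_history k : filtration_infty F `<=` history k.
Proof.
by move=> A FA; exists A, (fun=> setT); split => //; rewrite past_valuesT setIT.
Qed.

Lemma history_setI k : setI_closed (history k).
Proof.
move=> _ _ [A [B [FA mB ->]]] [A' [B' [FA' mB' ->]]].
exists (A `&` A'), (fun j => B j `&` B' j); split.
- exact: filtration_inftyI.
- by move=> j; apply: measurableI.
rewrite setIACA; congr (_ `&` _); apply/seteqP; split => w; rewrite /= !past_valuesP.
  by move=> [h h'] j jk; split; [exact: h | exact: h'].
by move=> h; split => j jk; have [] := h j jk.
Qed.

Lemma past_values_sigma k B : (forall j, measurable (B j)) ->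
  sigma_of_sequence E (past_values k B).
Proof.
move=> mB; rewrite /past_values.
set G := \bigcup_k preimage_set_system [set: T] (E k) measurable.
have : measurable (past_values k B : set (g_sigma_algebraType G)).
  elim: k => [|k IH].
    by rewrite (_ : past_values 0 B = setT) //; apply/seteqP; split.
  rewrite past_valuesS; apply: measurableI => //; apply: sub_sigma_algebra.
  by exists k => //; exists (B k) => //; rewrite setTI.
exact.
Qed.

Lemma past_values_measurable k B : (forall j, measurable (B j)) ->
  measurable (past_values k B).
Proof.
move=> mB; elim: k => [|k IH].
  by rewrite (_ : past_values 0 B = setT) //; apply/seteqP; split.
rewrite past_valuesS; apply: measurableI => //.
by rewrite -[X in measurable X]setTI; exact: measurable_funPT.
Qed.

Lemma history_measurable k : history k `<=` measurable.
Proof.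
move=> _ [A [B [FA mB ->]]]; apply: measurableI.
  exact: filtration_infty_measurable.
exact: past_values_measurable.
Qed.

Lemma historyS k : history k `<=` history k.+1.
Proof.
move=> _ [A [B [FA mB ->]]].
exists A, (fun j => if (j < k)%N then B j else setT); split => //.
  by move=> j; case: ifP.
rewrite past_valuesS ltnn preimage_setT setIT; congr (_ `&` _).
by apply/seteqP; split => w; rewrite !past_valuesP => h j jk; have := h j jk; rewrite jk.
Qed.

Lemma history_le j k : (j <= k)%N -> history j `<=` history k.
Proof.
by move=> /subnKC <-; elim: (k - j)%N => [|n IH]; rewrite ?addn0 // addnS => A /IH /historyS.
Qed.

Definition past k : set_system T := <<s history k >>.

Lemma past_le j k : (j <= k)%N -> past j `<=` past k.
Proof. by move=> jk; apply: sub_smallest2r; [exact: smallest_sigma_algebra | exact: history_le]. Qed.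

Lemma past_measurable k : past k `<=` measurable.
Proof.
apply: smallest_sub; [exact: sigma_algebra_measurable | exact: history_measurable].
Qed.

Lemma measurable_past_le {d' : measure_display} {Y : measurableType d'} (f : T -> Y) j k :
  (j <= k)%N -> measurable_fun setT (f : g_sigma_algebraType (history j) -> Y) ->
  measurable_fun setT (f : g_sigma_algebraType (history k) -> Y).
Proof. by move=> jk mf _ B mB; apply: (past_le jk); apply: mf. Qed.

Lemma measurable_past {d' : measure_display} {Y : measurableType d'} (f : T -> Y) k :
  measurable_fun setT (f : g_sigma_algebraType (history k) -> Y) ->
  measurable_fun setT f.
Proof. by move=> mf _ B mB; apply: (@past_measurable k); apply: mf. Qed.

Lemma measurable_value k :
  measurable_fun setT (E k : g_sigma_algebraType (history k.+1) -> R).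
Proof.
move=> _ B mB; rewrite setTI; apply: sub_sigma_algebra.
exists setT, (fun j => if j == k then B else setT); split.
- exact: (@measurableT _ (g_sigma_algebraType (\bigcup_(t in `[0, +oo[) F t))).
- by move=> j; case: ifP.
rewrite setTI past_valuesS eqxx (_ : past_values _ _ = setT) ?setTI //.
by apply/seteqP; split => // w _; apply/past_valuesP => j jk; rewrite ltn_eqF.
Qed.

Hypotheses (E_indep : mutually_independent P E)
  (E_F_indep : independent_classes P (sigma_of_sequence E) (filtration_infty F)).

(** On the generating rectangles, independence from F_oo is used twice, with k + 1 and with k
    factors, and mutual independence splits off the last factor. *)
Lemma past_indep k A B : past k A -> measurable B ->
  (P (A `&` E k @^-1` B) = P A * P (E k @^-1` B))%E.
Proof.
move=> pA mB; apply: (independent_g_sigma (G := history k)) => //.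
- exact: history_measurable.
- exact: history_setI.
- apply: sub_history.
  exact: (@measurableT _ (g_sigma_algebraType (\bigcup_(t in `[0, +oo[) F t))).
- by rewrite -[X in measurable X]setTI; exact: measurable_funPT.
move=> _ [A' [B' [FA' mB' ->]]].
(* Placing B at index k makes the event intersected with {E_k in B} a rectangle of length k + 1. *)
pose B'' j := if j == k then B else B' j.
have mB'' j : measurable (B'' j) by rewrite /B''; case: ifP.
have eB : past_values k B' = past_values k B''.
  by apply/seteqP; split => w; rewrite !past_valuesP => h j jk;
    have := h j jk; rewrite /B'' ltn_eqF.
have Bk : B = B'' k by rewrite /B'' eqxx.
rewrite eB {1}Bk -setIA -past_valuesS.
rewrite setIC E_F_indep //; last exact: past_values_sigma.
rewrite setIC E_F_indep //; last exact: past_values_sigma.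
rewrite /past_values !E_indep ?iota_uniq // -addn1 iotaD big_cat /= big_seq1.
by rewrite add0n -Bk muleAC.
Qed.

End history.

(** * Counting along integer-valued paths *)

Lemma lim_eventually_cst {R : realType} (f : R -> nat) (s : R) (n : nat) :
  (\forall u \near s^'-, f u = n) -> lim (f u @[u --> s^'-]) = n.
Proof.
move=> fn; apply: cvg_lim; first exact: order_hausdorff.
apply: cvg_near_cst; by near=> u; near: u.
Unshelve. all: by end_near. Qed.

(* When p is nondecreasing and eventually true, the number of k with p k false. *)
Definition count_failures (p : nat -> bool) : nat :=
  xget 0%N [set n | forall k, (n <= k)%N = p k].

Lemma count_failuresP (p : nat -> bool) k0 :
  (forall j k, (j <= k)%N -> p j -> p k) -> p k0 ->
  forall k, (count_failures p <= k)%N = p k.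
Proof.
move=> pm pk0; rewrite /count_failures; case: xgetP => [n -> //|] /=.
have ex : exists k, p k by exists k0.
case: (ex_minnP ex) => m pm0 mmin /(_ m)[] k.
by apply/idP/idP => [/pm|]; [apply | exact: mmin].
Qed.

Lemma count_failures_unique p n :
  (forall k, (n <= k)%N = p k) -> count_failures p = n.
Proof.
move=> np; have pm j k : (j <= k)%N -> p j -> p k.
  by rewrite -!np => jk nj; exact: leq_trans nj jk.
have pn : p n by rewrite -np.
have h := count_failuresP pm pn.
by apply/eqP; rewrite eqn_leq h pn np -h leqnn.
Qed.

Lemma series_failures {R : realType} (p : nat -> bool) n :
  (forall k, (n <= k)%N = p k) ->
  (\sum_(0 <= k <oo) (~~ p k)%:R%:E = n%:R%:E :> \bar R)%E.
Proof.
move=> np; apply: cvg_lim => //; apply: cvg_near_cst.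
exists n => // m /= nm.
rewrite (big_cat_nat (leq0n n) nm) /= (eq_big_nat _ _ (F2 := fun=> 1%E)); last first.
  by move=> k /andP[_ kn]; rewrite -np leqNgt kn.
rewrite [X in (_ + X)%E]big_nat_cond [X in (_ + X)%E]big1 ?adde0; last first.
  by move=> k /andP[/andP[nk _] _]; rewrite -np nk.
rewrite -[in RHS](subn0 n).
elim: n {np nm} => [|n IH]; first by rewrite big_geq.
by rewrite big_nat_recr //= IH -EFinD !subn0 -natr1.
Qed.

(** * Null sets of a product measure and section integrals *)

Section almost_everywhere_sections.
Context {d1 d2 : measure_display} {T1 : measurableType d1} {T2 : measurableType d2}
  {R : realType}.
Variables (m1 : {sigma_finite_measure set T1 -> \bar R})
  (m2 : {sigma_finite_measure set T2 -> \bar R}).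

Let ge0_ae_eq0 d (T : measurableType d) (m : {measure set T -> \bar R}) (f : T -> \bar R) :
  measurable_fun setT f -> (forall x, 0 <= f x)%E -> (\int[m]_x f x = 0)%E ->
  {ae m, forall x, f x = 0%E}.
Proof.
move=> mf f0 If; have : (\int[m]_x `|f x| = 0)%E.
  by rewrite -If; apply: eq_integral => x _; rewrite gee0_abs.
move/(ae_eq_integral_abs m measurableT mf).
by apply: filterS => x; apply.
Qed.

(** The indicator of a covering null set has integral 0; by Tonelli in either order, almost all of
    its sections have integral 0 too. *)
Lemma ae_sections (Q : T1 * T2 -> Prop) :
  {ae (m1 \x m2)%E, forall p, Q p} ->
  {ae m1, forall x, {ae m2, forall y, Q (x, y)}} /\
  {ae m2, forall y, {ae m1, forall x, Q (x, y)}}.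
Proof.
move=> [N [mN N0 QN]].
pose f (p : T1 * T2) : \bar R := (\1_N p)%:E.
have mf : measurable_fun setT f by apply/measurable_EFinP; exact: measurable_indic.
have f0 p : (0 <= f p)%E by rewrite lee_fin.
have If : (\int[m1 \x m2]_p f p = 0)%E by rewrite integral_indic // setIT.
have fQ p : f p = 0%E -> Q p.
  move=> fp; apply: contrapT => nQ; have /mem_set Np := QN p nQ.
  by move: fp; rewrite /f indicE Np => -[] /eqP; rewrite oner_eq0.
split.
  have := If; rewrite fubini_tonelli1 // => /ge0_ae_eq0.
  have h1 : measurable_fun setT (fubini_F m2 f) by exact: measurable_fun_fubini_tonelli_F.
  have h2 x : (0 <= fubini_F m2 f x)%E by apply: integral_ge0.
  move=> /(_ h1 h2); apply: filterS => x /ge0_ae_eq0.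
  have h3 : measurable_fun setT (fun y => f (x, y)) by exact: measurableT_comp.
  by move=> /(_ h3 (fun y => f0 (x, y))); apply: filterS => y; exact: fQ.
have := If; rewrite fubini_tonelli2 // => /ge0_ae_eq0.
have h1 : measurable_fun setT (fubini_G m1 f) by exact: measurable_fun_fubini_tonelli_G.
have h2 y : (0 <= fubini_G m1 f y)%E by apply: integral_ge0.
move=> /(_ h1 h2); apply: filterS => y /ge0_ae_eq0.
have h3 : measurable_fun setT (fun x => f (x, y)) by exact: measurableT_comp.
by move=> /(_ h3 (fun x => f0 (x, y))); apply: filterS => x; exact: fQ.
Qed.

Lemma null_sections (N : set (T1 * T2)) : measurable N ->
  (forall x, m2 [set y | N (x, y)] = 0%E) -> (m1 \x m2)%E N = 0%E.
Proof.
move=> mN N0; rewrite -[N]setIT -integral_indic // fubini_tonelli1 //; first last.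
- by apply/measurable_EFinP; exact: measurable_indic.
apply: integral0_eq => x _; rewrite /fubini_F.
have mS : measurable [set y | N (x, y)].
  have := measurable_xsection x mN; congr (measurable _).
  by apply/seteqP; split => y /=; rewrite /xsection /= inE.
rewrite (_ : (fun y => _) = fun y => (\1_[set y | N (x, y)] y)%:E).
  by rewrite integral_indic // setIT; exact: N0.
by apply/funext => y; rewrite !indicE; congr (_ %:R%:E); congr nat_of_bool; apply/idP/idP; rewrite !inE.
Qed.

End almost_everywhere_sections.

(** The integrand has no sign and need not be integrable on every section. Tonelli is applied to its
    positive and negative parts separately, and the difference is measurable whatever its values. *)
Lemma measurable_Rintegral_itv {d : measure_display} {T : measurableType d} {R : realType}
    (f : T * R -> R) (a b : R) : measurable_fun setT f ->
  measurable_fun setT (fun w => \int[lebesgue_measure]_(s in `[a, b]) f (w, s)).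
Proof.
move=> mf.
pose g (p : T * R) : \bar R := (if (a <= p.2 <= b)%R then f p else 0)%:E.
have mg : measurable_fun setT g.
  apply/measurable_EFinP; apply: measurable_fun_ifT => //.
  by apply: measurable_and; apply: measurable_fun_ler => //; exact: measurable_cst.
rewrite (_ : (fun w => _) = fine \o (fun w => fubini_F lebesgue_measure (g^\+)%E w -
    fubini_F lebesgue_measure (g^\-)%E w)%E).
  apply: measurableT_comp => //; apply: emeasurable_funB.
    by apply: measurable_fun_fubini_tonelli_F => //; exact: measurable_funepos.
  by apply: measurable_fun_fubini_tonelli_F => //; exact: measurable_funeneg.
apply/funext => w; rewrite /Rintegral /= integral_mkcond integralE; congr fine.
have -> : ((fun s => (f (w, s))%:E) \_ `[a, b] = g \o pair w)%E.
  by apply/funext => s; rewrite patchE mem_setE in_itv /g /=; case: ifP.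
by congr (_ - _)%E; apply: eq_integral => s _; rewrite ?funeposE ?funenegE.
Qed.

Lemma measurable_fun_nat {d : measure_display} {Y : measurableType d} (f : nat -> Y) :
  measurable_fun setT f.
Proof. by []. Qed.

Lemma clip_id {R : realType} (L U x : R) : L <= x <= U -> Num.max L (Num.min U x) = x.
Proof. by move=> /andP[Lx xU]; rewrite min_r // max_r. Qed.

Lemma clip_bounds {R : realType} (L U x : R) : L <= U -> L <= Num.max L (Num.min U x) <= U.
Proof. by move=> LU; rewrite le_max lexx /= ge_max LU ge_min lexx. Qed.

Lemma measurable_le_sets {d : measure_display} {S : measurableType d} {R : realType}
    (f : S -> R) :
  (forall t, measurable [set w | f w <= t]) -> measurable_fun setT f.
Proof.
move=> mf; apply: (measurability _ (RGenOInfty.measurableE R)) => //.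
move=> _ [_ [x ->] <-]; rewrite setTI (_ : _ @^-1` _ = ~` [set w | f w <= x]).
  exact: measurableC.
apply/seteqP; split => w /=; rewrite in_itv /= andbT ltNge; first by move/negP.
by move/negP.
Qed.

(** * The counting process *)

Section jump_times.
Context {d : measure_display} {T : measurableType d} {R : realType}.
Variables (P : probability T R) (F : R -> set_system T) (E : nat -> {RV P >-> R}).
Variables (e : T * R -> R) (lam : nat -> R -> R) (L U : R).
Local Notation mu := (@lebesgue_measure R).
Local Notation TH k := (g_sigma_algebraType (history F E k)).

(** The rate out of a level uses the joint law of [e] and the current jump time only, so plain
    recursion on the level suffices. The lower bound L^2 / U on the rates makes every passage time
    finite. *)
Fixpoint tau k : T -> R :=
  if k is k'.+1 then fun w =>
    passage (fun r => rate e (lam k')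
               (mimicking_rate P e (lam k') (tau k') L U) (w, r))
            (tau k' w) (E k' w)
  else fun=> 0.

Definition gam k := mimicking_rate P e (lam k) (tau k) L U.

Definition rho k := rate e (lam k) (gam k).

Definition cum k t w := cumul (fun r => rho k (w, r)) (tau k w) t.

Hypotheses (usualF : usual_conditions P F) (L_gt0 : 0 < L) (L_le_U : L <= U).
Hypotheses (me : measurable_fun setT (e : TH 0 * R -> R))
  (eLU : forall p, L <= e p <= U).
Hypotheses (mlam : forall k, measurable_fun setT (lam k))
  (lamLU : forall k t, L <= lam k t <= U).
Hypotheses (E_indep : mutually_independent P E)
  (E_F_indep : independent_classes P (sigma_of_sequence E) (filtration_infty F))
  (E_exp : forall k, exp1_distributed P (E k)).

Lemma measurable_state_past k : measurable_fun setT (e : TH k * R -> R).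
Proof.
apply: (@measurableT_comp _ _ _ (TH k * R)%type (TH 0 * R)%type R e setT id) => //.
apply/measurable_fun_pairP; split; last exact: measurable_snd.
apply: (@measurableT_comp _ _ _ (TH k * R)%type (TH k) (TH 0) id); last exact: measurable_fst.
move=> _ B mB; rewrite setTI; exact: (past_le (leq0n k)).
Qed.

Lemma measurable_state : measurable_fun setT e.
Proof.
apply: (@measurableT_comp _ _ _ (T * R)%type (TH 0 * R)%type R e setT id) => //.
apply/measurable_fun_pairP; split; last exact: measurable_snd.
apply: (@measurableT_comp _ _ _ (T * R)%type T (TH 0) id); last exact: measurable_fst.
move=> _ B mB; rewrite setTI; exact: (@past_measurable _ _ _ P F E usualF 0 B mB).
Qed.

Let U_gt0 : 0 < U. Proof. exact: lt_le_trans L_le_U. Qed.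

Let c_gt0 : 0 < L * L / U. Proof. by rewrite divr_gt0 ?mulr_gt0. Qed.

Section one_step.
Variable k : nat.
Hypotheses (mtau : measurable_fun setT (tau k : TH k -> R))
  (tau_ge0' : forall w, 0 <= tau k w).

Let mtau' : measurable_fun setT (tau k).
Proof. exact: (measurable_past usualF mtau). Qed.

Lemma admissible_gam_step : admissible L U (gam k).
Proof. exact: admissible_mimicking_rate measurable_state eLU _ _ _ _. Qed.

Let Ag := admissible_gam_step.

Lemma rho_bounds_step p : 0 <= rho k p <= U * U / L.
Proof. exact: rate_ge0. Qed.

Lemma rho_ge_step p : L * L / U <= rho k p.
Proof. by have /andP[] := rate_bounds L_gt0 L_le_U eLU (lamLU k) p Ag. Qed.

Lemma measurable_rho_past_step : measurable_fun setT (rho k : TH k * R -> R).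
Proof.
have h := @measurable_rate _ (TH k) R e (lam k) L U L_gt0 (@measurable_state_past k) (mlam k) (gam k) Ag.
rewrite /rho.
exact: h.
Qed.

Lemma measurable_rho1_step w : measurable_fun setT (fun r => rho k (w, r)).
Proof.
by apply: (@measurableT_comp _ _ _ R (TH k * R)%type R (rho k)) => //;
  exact: measurable_rho_past_step.
Qed.

Lemma measurable_cum_step t : measurable_fun setT (cum k t : TH k -> R).
Proof.
apply: (@measurableT_comp _ _ _ (TH k) (TH k * R)%type R
  (fun p => cumul (fun r => rho k (p.1, r)) (tau k p.1) p.2) _ (fun w => (w, t))) => //.
apply: (@measurable_cumul _ (TH k) R (rho k) (tau k)) => //.
  exact: measurable_rho_past_step.
by move=> p; have /andP[] := rho_bounds_step p.
Qed.

Lemma tauS_le_step w t : tau k.+1 w <= t <-> tau k w <= t /\ E k w <= cum k t w.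
Proof.
apply: (passage_le (c := L * L / U) (C := U * U / L)) => //.
- exact: measurable_rho1_step.
- by move=> r; exact: rho_bounds_step.
- by move=> r; exact: rho_ge_step.
Qed.

End one_step.

(** The properties of [rho k] presuppose that [tau k] is measurable and nonnegative, while
    [tau k.+1] is built from [rho k]; hence one joint induction. {tau_{k+1} <= t} is the
    intersection of {tau_k <= t} and {E_k <= cum k t}, and E_k is known given H_{k+1}. *)
Lemma tau_step k : measurable_fun setT (tau k : TH k -> R) /\ forall w, 0 <= tau k w.
Proof.
elim: k => [|k [IHm IH0]]; first by split=> [|w]; [exact: measurable_cst | exact: lexx].
split; last first.
  by move=> w; apply: (le_trans (IH0 w)); have [+ _] := tauS_le_step IHm IH0 w (tau k.+1 w);
     rewrite lexx => /(_ isT) [].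
apply: (@measurable_le_sets _ (TH k.+1)) => t.
have mt : measurable_fun setT (tau k : TH k.+1 -> R) by apply: measurable_past_le IHm.
have mc : measurable_fun setT (cum k t : TH k.+1 -> R).
  by apply: measurable_past_le (measurable_cum_step IHm IH0 t).
have mE := @measurable_value _ _ _ P F E k.
rewrite (_ : [set w | _] = (tau k @^-1` `]-oo, t]) `&`
    ((fun w => E k w - cum k t w) @^-1` `]-oo, 0])).
  apply: measurableI.
    by rewrite -[X in measurable X]setTI; apply: mt.
  by rewrite -[X in measurable X]setTI; apply: measurable_funB.
apply/seteqP; split => w /=; rewrite !in_itv /= subr_le0;
  by move/(tauS_le_step IHm IH0).
Qed.

Lemma measurable_tau_past k : measurable_fun setT (tau k : TH k -> R).
Proof. by case: (tau_step k). Qed.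

Lemma measurable_tau k : measurable_fun setT (tau k).
Proof. exact: (measurable_past usualF (@measurable_tau_past k)). Qed.

Lemma tau_ge0 k w : 0 <= tau k w.
Proof. by case: (tau_step k). Qed.

Lemma admissible_gam k : admissible L U (gam k).
Proof. by have [] := tau_step k; exact: admissible_gam_step. Qed.

Lemma rho_bounds k p : 0 <= rho k p <= U * U / L.
Proof. by have [a b] := tau_step k; exact: rho_bounds_step. Qed.

Lemma rho_ge k p : L * L / U <= rho k p.
Proof. by have [a b] := tau_step k; exact: rho_ge_step. Qed.

Lemma measurable_rho_past k : measurable_fun setT (rho k : TH k * R -> R).
Proof. by have [a b] := tau_step k; exact: measurable_rho_past_step. Qed.

Lemma measurable_rho1 k w : measurable_fun setT (fun r => rho k (w, r)).
Proof. by have [a b] := tau_step k; exact: measurable_rho1_step. Qed.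

Lemma measurable_cum_past k t : measurable_fun setT (cum k t : TH k -> R).
Proof. by have [a b] := tau_step k; exact: measurable_cum_step. Qed.

Lemma measurable_cum k t : measurable_fun setT (cum k t).
Proof. exact: (measurable_past usualF (@measurable_cum_past k t)). Qed.

Lemma tauS_le k w t : tau k.+1 w <= t <-> tau k w <= t /\ E k w <= cum k t w.
Proof. by have [a b] := tau_step k; exact: tauS_le_step. Qed.

Lemma tau_leS k w : tau k w <= tau k.+1 w.
Proof. by have [+ _] := tauS_le k w (tau k.+1 w); rewrite lexx => /(_ isT) []. Qed.

Lemma tau_le w j k : (j <= k)%N -> tau j w <= tau k w.
Proof.
by move=> /subnKC <-; elim: (k - j)%N => [|n IH]; rewrite ?addn0 // addnS;
  exact: le_trans IH (tau_leS _ _).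
Qed.

Lemma cum_ge0 k t w : 0 <= cum k t w.
Proof. by apply: (cumul_ge0 (C := U * U / L)) => r; exact: rho_bounds. Qed.

Lemma tau_lt k w : 0 < E k w -> tau k w < tau k.+1 w.
Proof.
move=> E0; rewrite ltNge; apply/negP => /tauS_le[_].
have := @cumul_le _ (fun r => rho k (w, r)) (U * U / L) (@measurable_rho1 k w)
  (fun r => rho_bounds k (w, r)) _ _ (lexx (tau k w)).
by rewrite subrr mulr0 -/(cum k _ w) => h1 h2; have := lt_le_trans E0 (le_trans h2 h1);
  rewrite ltxx.
Qed.

(** The compensator of the single jump at [tau k.+1]. The truncation at 0 covers the null event
    where E_k is negative. *)
Definition step_compensator k t w := Num.min (Num.max 0 (E k w)) (cum k t w).

Lemma step_compensator_ge0 k t w : 0 <= step_compensator k t w.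
Proof. by rewrite le_min le_max lexx cum_ge0. Qed.

Lemma cum_homo k w : {homo (fun t => cum k t w) : s t / s <= t}.
Proof.
move=> s t st.
exact: (cumul_homo (@measurable_rho1 k w) (fun r => rho_bounds k (w, r))).
Qed.

Lemma measurable_step_compensator k t : measurable_fun setT (step_compensator k t).
Proof.
apply: measurable_minr; last exact: measurable_cum.
by apply: measurable_maxr => //; exact: measurable_funPT.
Qed.

Lemma step_compensator_integral k t w : 0 <= E k w ->
  (\int[mu]_(r in `[0%R, t])
     ((tau k w <= r < tau k.+1 w)%R%:R * rho k (w, r))%:E = (step_compensator k t w)%:E)%E.
Proof.
move=> E0.
rewrite (@integral_before_passage _ (fun r => rho k (w, r)) (L * L / U) (U * U / L)) //.
- by rewrite /step_compensator max_r.
- exact: measurable_rho1.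
- by move=> r; exact: rho_bounds.
- by move=> r; exact: rho_ge.
- exact: tau_ge0.
Qed.

(** The rate is at most U^2 / L and acts only between two consecutive jump times. The bound has this
    form because it telescopes over k. *)
Lemma step_compensator_le k t w :
  step_compensator k t w <= U * U / L * (Num.min t (tau k.+1 w) - Num.min t (tau k w)).
Proof.
case: (leP 0 (E k w)) => E0; last first.
  rewrite /step_compensator (max_l (ltW E0)) min_l ?cum_ge0 // mulr_ge0 //.
    by rewrite divr_ge0 ?mulr_ge0 // ltW.
  by rewrite subr_ge0 le_min ge_min lexx /= ge_min tau_leS orbT.
rewrite /step_compensator max_r //.
rewrite -(@cumul_min_passage _ (fun r => rho k (w, r)) (L * L / U) (U * U / L)) //.
- rewrite -/(tau k.+1 w) -/(gam k).
  have tt := tau_leS k w.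
  case: (leP t (tau k w)) => [tk|kt].
    rewrite (min_l (le_trans tk tt)) subrr mulr0.
    move: tk; rewrite le_eqVlt => /orP[/eqP tk|tk].
      have := @cumul_le _ (fun r => rho k (w, r)) (U * U / L) (@measurable_rho1 k w)
        (fun r => rho_bounds k (w, r)) _ _ (lexx (tau k w)).
      by rewrite subrr mulr0 tk.
    by rewrite cumul_lt.
  apply: (@cumul_le _ (fun r => rho k (w, r)) (U * U / L) (@measurable_rho1 k w)
    (fun r => rho_bounds k (w, r))).
  by rewrite le_min (ltW kt).
- exact: measurable_rho1.
- by move=> r; exact: rho_bounds.
- by move=> r; exact: rho_ge.
Qed.

(** The identity, seen as a random variable with values in the space carrying H_k: freezing it
    amounts to conditioning on H_k. *)
Let past_id k : (id : T -> TH k) \in mfun.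
Proof. by rewrite inE /= => _ B mB; rewrite setTI; exact: (@past_measurable _ _ _ P F E usualF k B mB). Qed.

Let past_id_indep k (A : set (TH k)) (B : set R) : measurable A -> measurable B ->
  (P (mfun_Sub (past_id k) @^-1` A `&` E k @^-1` B) =
   P (mfun_Sub (past_id k) @^-1` A) * P (E k @^-1` B))%E.
Proof. exact: (past_indep usualF E_indep E_F_indep). Qed.

Lemma survival_expectation k t (Z : T -> R) :
  measurable_fun setT (Z : TH k -> R) -> (forall w, 0 <= Z w) ->
  (\int[P]_w (Z w * (cum k t w < E k w)%R%:R)%:E =
   \int[P]_w (Z w * expR (- cum k t w))%:E)%E.
Proof.
move=> mZ Z0.
exact: (freezing_gt (@past_id_indep k) (E_exp k) mZ (@measurable_cum_past k t) Z0 (@cum_ge0 k t)).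
Qed.

Lemma compensator_expectation k t (Z : T -> R) :
  measurable_fun setT (Z : TH k -> R) -> (forall w, 0 <= Z w) ->
  (\int[P]_w (Z w * (E k w <= cum k t w)%R%:R)%:E =
   \int[P]_w (Z w * step_compensator k t w)%:E)%E.
Proof.
move=> mZ Z0.
exact: (freezing_min (@past_id_indep k) (E_exp k) mZ (@measurable_cum_past k t) Z0 (@cum_ge0 k t)).
Qed.

Lemma level_indicator k t w :
  ((tau k w <= t < tau k.+1 w)%R%:R = (tau k w <= t)%R%:R * (cum k t w < E k w)%R%:R :> R).
Proof.
case: (leP (tau k w) t) => kt; last by rewrite mul0r.
rewrite mul1r (_ : true && _ = (cum k t w < E k w)) //.
rewrite /= !ltNge; congr (~~ _).
by apply/idP/idP => [/tauS_le[]//|h]; apply/tauS_le.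
Qed.

(** Conditioning on H_k replaces the indicator of the level by [survival] on both sides, which
    reduces the claim to the fixed-point identity. *)
Lemma level_balance k t :
  (\int[P]_w (e (w, t) * (tau k w <= t < tau k.+1 w)%R%:R)%:E =
   (gam k t)%:E * \int[P]_w ((tau k w <= t < tau k.+1 w)%R%:R)%:E)%E.
Proof.
have m1 : measurable_fun setT (fun w : TH k => (tau k w <= t)%R%:R : R).
  by apply: measurable_natr; apply: measurable_fun_ler => //; exact: measurable_tau_past.
have met : measurable_fun setT (fun w : TH k => e (w, t)).
  by apply: measurableT_comp => //; exact: measurable_state_past.
have e0 p : 0 <= e p by have /andP[+ _] := eLU p; apply: le_trans; exact: ltW.
have es0 w : 0 <= e (w, t) * (tau k w <= t)%R%:R by rewrite mulr_ge0.
under eq_integral do rewrite level_indicator mulrA.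
rewrite (survival_expectation t (measurable_funM met m1) es0).
under [in RHS]eq_integral do rewrite level_indicator.
rewrite (survival_expectation t m1 (fun w => ler0n _ _)).
have s01 w := survival_bounds (tau k) L_gt0 L_le_U eLU (lamLU k) (w, t) (admissible_gam k).
have ms : measurable_fun setT (fun w => survival e (lam k) (tau k) (gam k) (w, t)).
  apply: measurableT_comp => //.
  exact: (measurable_survival L_gt0 L_le_U measurable_state eLU (mlam k) (lamLU k)
    (@measurable_tau k) (admissible_gam k)).
have s_norm w : `|survival e (lam k) (tau k) (gam k) (w, t)| <= 1.
  have /andP[s0 s1] := s01 w; rewrite ger0_norm //; apply: (le_trans s1) => /=.
  by case: (tau k w <= t); rewrite ?lexx ?ler01.
have es_norm w : `|e (w, t) * survival e (lam k) (tau k) (gam k) (w, t)| <= U.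
  rewrite normrM ger0_norm // -[leRHS]mulr1; apply: ler_pM => //.
  by case/andP: (eLU (w, t)).
have Is := bounded_integrable P ms s_norm.
have mes : measurable_fun setT (fun w => e (w, t) * survival e (lam k) (tau k) (gam k) (w, t)).
  by apply: measurable_funM => //; exact: (measurable_past usualF met).
have Ies := bounded_integrable P mes es_norm.
have := mimicking_rate_balance P L_gt0 L_le_U measurable_state eLU (mlam k) (lamLU k)
  (@measurable_tau k) (@tau_ge0 k) t.
rewrite -/(gam k) /Rintegral => h.
transitivity (\int[P]_w (e (w, t) * survival e (lam k) (tau k) (gam k) (w, t))%:E)%E.
  by apply: eq_integral => w _; rewrite mulrA.
transitivity ((gam k t)%:E * \int[P]_w (survival e (lam k) (tau k) (gam k) (w, t))%:E)%E => //.
rewrite -[LHS]fineK; last exact: integrable_fin_num Ies.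
by rewrite h EFinM fineK //; exact: integrable_fin_num Is.
Qed.

#[local] Opaque tau.

(** Positive E_k make the jump times strictly increasing; the second clause excludes explosion and
    is stated with integers to keep the event a countable combination. *)
Definition good : set T :=
  [set w | (forall k, 0 < E k w) /\ forall n : nat, exists k, n%:R < tau k w].

Let C := U * U / L.

Let C_ge0 : 0 <= C.
Proof. by rewrite divr_ge0 ?mulr_ge0 ?(ltW L_gt0) // (le_trans (ltW L_gt0)). Qed.

Lemma sum_step_compensator_le m t w : 0 <= t -> \sum_(0 <= k < m) step_compensator k t w <= C * t.
Proof.
move=> t0; apply: (le_trans (ler_sum_nat (fun k _ => step_compensator_le k t w))).
rewrite -mulr_sumr telescope_sumr // ler_wpM2l //.
rewrite (min_r t0) subr0 ge_min lexx //.
Qed.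

(** Only an inequality: when E_k <= 0, the event {E_k <= cum k t} also occurs at times before
    [tau k]. *)
Lemma le_measure_step_compensator k t :
  (P [set w | (tau k.+1 w <= t)%R] <= \int[P]_w (step_compensator k t w)%:E)%E.
Proof.
have mA : measurable [set w | (tau k.+1 w <= t)%R].
  by apply: measurable_bool_set; apply: measurable_fun_ler => //; exact: measurable_tau.
have -> : (\int[P]_w (step_compensator k t w)%:E =
    \int[P]_w (1 * (E k w <= cum k t w)%R%:R)%:E)%E.
  rewrite (@compensator_expectation k t (fun=> 1) (@measurable_cst _ _ (TH k) R setT 1) (fun=> ler01)).
  by apply: eq_integral => w _; rewrite mul1r.
rewrite -[X in P X]setIT -integral_indic //.
apply: ge0_le_integral => //.
- exact/measurable_EFinP/measurable_indic.
- apply/measurable_EFinP; apply: measurable_funM => //; apply: measurable_natr.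
  apply: measurable_fun_ler; [exact: measurable_funPT | exact: measurable_cum].
- move=> w _; rewrite mul1r lee_fin indicE; case: (boolP (w \in _)) => //.
  by rewrite inE /= => /tauS_le[_ ->].
Qed.

(** The event lies in every {tau_{k+1} <= n}. Summing over k < m bounds m times its probability by C
    n for all m, so the probability is 0. *)
Lemma measure_bounded_tau0 n : P (\bigcap_k [set w | (tau k w <= n%:R)%R]) = 0%E.
Proof.
have mA k : measurable [set w | (tau k w <= n%:R)%R].
  by apply: measurable_bool_set; apply: measurable_fun_ler => //; exact: measurable_tau.
set B := \bigcap_k _.
have mB : measurable B by exact: bigcapT_measurable.
have PB : P B \is a fin_num by exact: fin_num_measure.
have h m : m%:R * fine (P B) <= C * n%:R.
  rewrite -lee_fin EFinM fineK //.
  apply: (@le_trans _ _ (\sum_(0 <= k < m) P [set w | (tau k.+1 w <= n%:R)%R])%E).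
    elim: m => [|m IH]; first by rewrite big_geq // mulr0n mul0e.
    rewrite big_nat_recr // -natr1 EFinD muleDl // mul1e; apply: leeD => //.
    apply: le_measure; [exact: mem_set | apply: mem_set; exact: (mA m.+1) |].
    by move=> w hw; exact: (hw m.+1 I).
  apply: (@le_trans _ _ (\sum_(0 <= k < m) \int[P]_w (step_compensator k n%:R w)%:E)%E).
    by apply: lee_sum => k _; exact: le_measure_step_compensator.
  rewrite -ge0_integral_sum //; first last.
  - by move=> k w _; rewrite lee_fin step_compensator_ge0.
  - by move=> k; apply/measurable_EFinP; exact: measurable_step_compensator.
  apply: (@le_trans _ _ (\int[P]_w (cst (C * n%:R)%:E w))%E).
    apply: ge0_le_integral => //.
    - by move=> w _; rewrite sume_ge0 // => k _; rewrite lee_fin step_compensator_ge0.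
    - by apply: emeasurable_sum => k; apply/measurable_EFinP; exact: measurable_step_compensator.
    - by move=> w _; rewrite sumEFin lee_fin sum_step_compensator_le.
  rewrite integral_cst // [X in (_ * X)%E](_ : _ = 1%E) ?mule1 //.
  exact: probability_setT.
apply/eqP; rewrite -(fineK PB) eqe eq_le fine_ge0 // andbT.
rewrite leNgt; apply/negP => B0.
have := h (Num.truncn (C * n%:R / fine (P B))).+1.
rewrite leNgt => /negP; apply; rewrite -ltr_pdivrMr //.
exact: truncnS_gt.
Qed.

Lemma measurable_good : measurable good.
Proof.
rewrite (_ : good = (\bigcap_k [set w | (0 < E k w)%R]) `&`
   \bigcap_n \bigcup_k [set w | (n%:R < tau k w)%R]).
  apply: measurableI; first apply: bigcapT_measurable => k.
    by apply: measurable_bool_set; apply: measurable_fun_ltr => //; exact: measurable_funPT.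
  apply: bigcapT_measurable => n; apply: bigcupT_measurable => k.
  by apply: measurable_bool_set; apply: measurable_fun_ltr => //; exact: measurable_tau.
apply/seteqP; split => w.
  move=> [Ew tw]; split => [k _|n _]; first exact: Ew.
  by have [k] := tw n; exists k.
move=> [Ew tw]; split => [k|n]; first exact: Ew.
by have [k _] := tw n I; exists k.
Qed.

Lemma good_ae : P (~` good) = 0%E.
Proof.
apply/negligibleP; first by apply: measurableC; exact: measurable_good.
apply: (@negligibleS _ _ _ P ((\bigcup_k [set w | (E k w <= 0)%R]) `|`
    \bigcup_n \bigcap_k [set w | (tau k w <= n%:R)%R])).
  move=> w ng; apply: contrapT => h; apply: ng; split => [k|n].
    by rewrite ltNge; apply/negP => Ek; apply: h; left; exists k.
  apply: contrapT => nt; apply: h; right; exists n => // k _ /=.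
  by rewrite leNgt; apply/negP => nk; apply: nt; exists k.
apply: negligibleU; apply: negligible_bigcup => k.
  apply/negligibleP; last exact: (exp1_gt0_ae (E_exp k)).
  apply: measurable_bool_set; apply: measurable_fun_ler => //; exact: measurable_funPT.
apply/negligibleP; last exact: measure_bounded_tau0.
apply: bigcapT_measurable => j.
by apply: measurable_bool_set; apply: measurable_fun_ler => //; exact: measurable_tau.
Qed.

Lemma past_null k A : measurable A -> P A = 0%E -> past F E k A.
Proof.
move=> mA PA; apply: sub_sigma_algebra; apply: sub_history.
have [_ _ /(_ _ mA PA) FA] := usualF.
exact: (sub_filtration_infty (lexx 0)).
Qed.

(** Although [good] involves all the E_j, it is the complement of a null event, and null events
    already belong to F_0. *)
Lemma past_good k : measurable (good : set (TH k)).
Proof.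
rewrite -[good]setCK; apply: measurableC; apply: past_null; last exact: good_ae.
by apply: measurableC; exact: measurable_good.
Qed.

(** The index is shifted because [tau 0 = 0] is a starting time and not a jump. Off [good] no jump
    ever occurs. *)
Definition arrival k w : \bar R := if `[< good w >] then (tau k.+1 w)%:E else +oo%E.

Lemma arrival_good k w : good w -> arrival k w = (tau k.+1 w)%:E.
Proof. by move=> gw; rewrite /arrival asboolT. Qed.

Lemma arrival_bad k w : ~ good w -> arrival k w = +oo%E.
Proof. by move=> gw; rewrite /arrival asboolF. Qed.

Lemma arrival_homo w j k : (j <= k)%N -> (arrival j w <= arrival k w)%E.
Proof.
move=> jk; have [gw|gw] := pselect (good w); last by rewrite !arrival_bad.
by rewrite !(arrival_good _ gw) lee_fin; exact: tau_le.
Qed.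

Lemma arrival_unbounded w (t : R) : exists k, (t%:E < arrival k w)%E.
Proof.
have [gw|gw] := pselect (good w); last by exists 0%N; rewrite arrival_bad // ltry.
have [k nk] := gw.2 (Num.truncn t).+1; exists k; rewrite arrival_good // lte_fin.
by apply: (lt_le_trans (truncnS_gt t)); apply: (le_trans (ltW nk)); exact: tau_leS.
Qed.

Lemma measurable_arrival_past k : measurable_fun setT (arrival k : TH k.+1 -> \bar R).
Proof.
apply: measurable_fun_ifT => //.
  have := @past_good k.+1.
  by move=> mg; apply: (measurable_fun_bool true); rewrite setTI;
    congr (measurable _): mg; apply/seteqP; split => w /= /asboolP.
by apply/measurable_EFinP; exact: measurable_tau_past.
Qed.

Lemma measurable_arrival k : measurable_fun setT (arrival k).
Proof. exact: (measurable_past usualF (@measurable_arrival_past k)). Qed.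

Definition jumps (t : R) (w : T) := count_failures (fun k => (t%:E < arrival k w)%E).

(** The left limit in closed form: the weak inequality leaves out a jump at time t itself, and joint
    measurability can be seen without taking limits. *)
Definition jumps_before (t : R) (w : T) :=
  count_failures (fun k => (t%:E <= arrival k w)%E).

Lemma jumps_le t w k : (jumps t w <= k)%N = (t%:E < arrival k w)%E.
Proof.
have [k0 tk0] := arrival_unbounded w t.
apply: count_failuresP tk0 k => j k jk tj.
by apply: lt_le_trans tj _; exact: arrival_homo.
Qed.

Lemma jumps_before_le t w k : (jumps_before t w <= k)%N = (t%:E <= arrival k w)%E.
Proof.
have [k0 /ltW tk0] := arrival_unbounded w t.
apply: count_failuresP tk0 k => j k jk tj.
by apply: le_trans tj _; exact: arrival_homo.
Qed.

Lemma jumps_homo w s t : s <= t -> (jumps s w <= jumps t w)%N.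
Proof.
move=> st; rewrite jumps_le; apply: (@le_lt_trans _ _ t%:E); first by rewrite lee_fin.
by rewrite -jumps_le.
Qed.

Lemma jumps_level t w k : good w -> 0 <= t ->
  (jumps t w == k) = (tau k w <= t < tau k.+1 w).
Proof.
move=> gw t0; rewrite eqn_leq jumps_le arrival_good // lte_fin andbC; congr (_ && _).
case: k => [|k]; first by rewrite leq0n t0.
by rewrite ltnNge jumps_le arrival_good // lte_fin -leNgt.
Qed.

(** If m + 1 jumps lie strictly before s, then [arrival m] is followed by a left neighbourhood of s
    free of further jumps. *)
Lemma jumps_near_left s w : \forall u \near s^'-, jumps u w = jumps_before s w.
Proof.
have [m mE] : exists m, m = jumps_before s w by exists (jumps_before s w).
rewrite -mE.
have le_m u : u < s -> (jumps u w <= m)%N.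
  move=> us; rewrite jumps_le; apply: (@lt_le_trans _ _ s%:E); first by rewrite lte_fin.
  by rewrite -jumps_before_le mE.
case: m mE le_m => [|m] mE le_m.
  by near=> u; apply/eqP; rewrite -leqn0; apply: le_m; near: u; exact: nbhs_left_lt.
have : (arrival m w < s%:E)%E by rewrite ltNge -jumps_before_le -mE ltnn.
case: (pselect (good w)) => gw; last by rewrite arrival_bad.
rewrite arrival_good // lte_fin => ms.
near=> u; apply/eqP; rewrite eqn_leq le_m ?ltnNge ?jumps_le ?arrival_good //=.
by rewrite lte_fin -leNgt; near: u; exact: nbhs_left_ge.
Unshelve. all: by end_near. Qed.

Lemma left_limit_jumps s w : left_limit jumps s w = jumps_before s w.
Proof. by apply: lim_eventually_cst; exact: jumps_near_left. Qed.

Lemma jumps_near_right t w : \forall u \near t^'+, jumps u w = jumps t w.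
Proof.
have : (t%:E < arrival (jumps t w) w)%E by rewrite -jumps_le.
have le_u u : t < u -> (u%:E < arrival (jumps t w) w)%E -> jumps u w = jumps t w.
  by move=> tu; rewrite -jumps_le => uj; apply/eqP; rewrite eqn_leq uj jumps_homo // ltW.
case: (pselect (good w)) => gw; last first.
  move=> _; near=> u; apply: le_u; last by rewrite arrival_bad // ltry.
  by near: u; exact: nbhs_right_gt.
rewrite arrival_good // lte_fin => ta; near=> u; apply: le_u.
  by near: u; exact: nbhs_right_gt.
by rewrite arrival_good // lte_fin; near: u; exact: nbhs_right_lt.
Unshelve. all: by end_near. Qed.

Lemma counting_process_jumps : counting_process P jumps.
Proof.
exists arrival; split.
- exact: measurable_arrival.
- exists (~` good); split => //; first by apply: measurableC; exact: measurable_good.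
    exact: good_ae.
  move=> w nQ gw; apply: nQ; split.
    rewrite arrival_good // -[X in (X < _)%E]/(0%:E) lte_fin.
    apply: (le_lt_trans (tau_ge0 0 w)).
    by apply: tau_lt; exact: gw.1.
  by move=> k; rewrite !arrival_good // lte_fin; apply: tau_lt; exact: gw.1.
- move=> t w t0; rewrite -(series_failures (jumps_le t w)).
  by apply: eq_eseriesr => k _; rewrite leNgt.
Qed.

Lemma measurable_jumps_joint : measurable_fun setT (fun p : T * R => jumps p.2 p.1).
Proof.
apply: measurable_nat_le => k.
rewrite (_ : [set _ | _] = [set p : T * R | (p.2%:E < arrival k p.1)%E]).
  rewrite -[X in measurable X]setTI; apply: measurable_lte => //.
    by apply/measurable_EFinP.
  by apply: measurableT_comp => //; exact: measurable_arrival.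
by apply/seteqP; split => p /=; rewrite jumps_le.
Qed.

Lemma measurable_jumps_before_joint :
  measurable_fun setT (fun p : T * R => jumps_before p.2 p.1).
Proof.
apply: measurable_nat_le => k.
rewrite (_ : [set _ | _] = [set p : T * R | (p.2%:E <= arrival k p.1)%E]).
  rewrite -[X in measurable X]setTI; apply: measurable_lee => //.
    by apply/measurable_EFinP.
  by apply: measurableT_comp => //; exact: measurable_arrival.
by apply/seteqP; split => p /=; rewrite jumps_before_le.
Qed.

(* On [jumps t <= k] the history up to time [t] does not involve E_k. *)
Lemma measurable_jumps_past k :
  measurable_fun setT (fun p : TH k * R => minn (jumps p.2 p.1) k).
Proof.
apply: measurable_nat_le => j; have [kj|jk] := leqP k j.
  rewrite (_ : [set _ | _] = setT) //; apply/seteqP; split => // p _ /=.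
  by rewrite geq_min kj orbT.
rewrite (_ : [set _ | _] = [set p : TH k * R | (p.2%:E < arrival j p.1)%E]).
  rewrite -[X in measurable X]setTI; apply: measurable_lte => //.
    by apply/measurable_EFinP.
  apply: (measurableT_comp (f := (arrival j : TH k -> \bar R))) => //.
  exact: measurable_past_le jk (@measurable_arrival_past j).
by apply/seteqP; split => p /=; rewrite geq_min jumps_le [(k <= j)%N]leqNgt jk orbF.
Qed.

(** * The enlarged filtration *)

(* Initially enlarged by F_oo: before the (k+1)-st jump an event of [enlarged t]
   coincides with an event generated by F_oo and E_0, ..., E_{k-1}. *)
Definition enlarged (t : R) : set_system T :=
  [set A | measurable A /\ forall k, exists2 B, past F E k B &
     A `&` [set w | (jumps t w <= k)%N] = B `&` [set w | (jumps t w <= k)%N]].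

Lemma enlarged_past t A : measurable A -> (forall k, past F E k A) -> enlarged t A.
Proof. by move=> mA pA; split => // k; exists A. Qed.

Lemma enlarged_sigma t : sigma_algebra [set: T] (enlarged t).
Proof.
split.
- by apply: enlarged_past => // k; exact: (@measurable0 _ (TH k)).
- move=> A [mA hA]; split; first exact: measurableD.
  move=> k; have [B pB AB] := hA k; exists (setT `\` B).
    by apply: (@measurableD _ (TH k)) => //; exact: (@measurableT _ (TH k)).
  apply/seteqP; split => w [[_ nA] Xk]; split => //; split => // Bw; apply: nA.
    by have [] : (A `&` [set w | (jumps t w <= k)%N]) w by rewrite AB.
  by have [] : (B `&` [set w | (jumps t w <= k)%N]) w by rewrite -AB.
- move=> A hA; split; first by apply: bigcupT_measurable => n; case: (hA n).
  move=> k; have /choice[B hB] : forall n, exists B, past F E k B /\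
      A n `&` [set w | (jumps t w <= k)%N] = B `&` [set w | (jumps t w <= k)%N].
    by move=> n; have [_ /(_ k)[B pB AB]] := hA n; exists B.
  exists (\bigcup_n B n).
    by apply: (@bigcupT_measurable _ (TH k)) => n; case: (hB n).
  by rewrite !setI_bigcupl; apply: eq_bigcupr => n _; case: (hB n).
Qed.

Lemma enlarged_homo s t : s <= t -> enlarged s `<=` enlarged t.
Proof.
move=> st A [mA hA]; split => // k; have [B pB AB] := hA k; exists B => //.
have -> : [set w | (jumps t w <= k)%N] =
    [set w | (jumps s w <= k)%N] `&` [set w | (jumps t w <= k)%N].
  by apply/seteqP; split => [w tk|w []//]; split => //; exact: leq_trans (jumps_homo w st) tk.
by rewrite !setIA AB.
Qed.

(** Paths are constant just after t, so a point with [jumps t w <= k] still has at most k jumps at t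
    + 1/(n + 1) for large n, where [A] and [B n] agree. Hence the lower limit of the [B n], an event
    of H_k, agrees with [A] on that set. *)
Lemma enlarged_right_continuous t : enlarged t = \bigcap_(s in `]t, +oo[) enlarged s.
Proof.
apply/seteqP; split => A.
  by move=> hA s; rewrite /= in_itv /= andbT => ts; exact: enlarged_homo (ltW ts) _ hA.
move=> hA.
have lt_s n : t < t + n.+1%:R^-1 by rewrite ltrDl.
have hAn n : enlarged (t + n.+1%:R^-1) A by apply: hA; rewrite /= in_itv /= lt_s.
split; first by case: (hAn 0%N).
move=> k; have /choice[B hB] : forall n, exists B, past F E k B /\
    A `&` [set w | (jumps (t + n.+1%:R^-1) w <= k)%N] =
    B `&` [set w | (jumps (t + n.+1%:R^-1) w <= k)%N].
  by move=> n; have [_ /(_ k)[B' pB AB]] := hAn n; exists B'.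
exists (\bigcup_m \bigcap_n B (m + n)%N).
  apply: (@bigcupT_measurable _ (TH k)) => m.
  by apply: (@bigcapT_measurable _ (TH k)) => n; case: (hB (m + n)%N).
have near_k w : (jumps t w <= k)%N ->
    exists m, forall n, (m <= n)%N -> A w <-> B n w.
  move=> tk; have := jumps_near_right t w; rewrite /at_right nearE /= => -[eps /= e0 he].
  have [m [_ meps]] : exists m, True /\ m.+1%:R^-1 < eps.
    exists (Num.truncn eps^-1); split => //.
    by rewrite invf_plt ?posrE //; exact: truncnS_gt.
  exists m => n mn.
  have Xn : (jumps (t + n.+1%:R^-1) w <= k)%N.
    rewrite he //= opprD addrA subrr add0r normrN ger0_norm //.
    by apply: le_lt_trans meps; rewrite lef_pV2 ?posrE // ler_nat ltnS.
  have [_ AB] := hB n; split => h.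
    by have [] : (B n `&` [set w | (jumps (t + n.+1%:R^-1) w <= k)%N]) w by rewrite -AB.
  by have [] : (A `&` [set w | (jumps (t + n.+1%:R^-1) w <= k)%N]) w by rewrite AB.
apply/seteqP; split => w /= [h tk]; split => //; have [m hm] := near_k w tk.
  by exists m => // n _; apply/(hm _ (leq_addr _ _)).
have [m' _ hm'] := h.
by apply/(hm (m' + m)%N (leq_addl _ _)); apply: hm'.
Qed.

Lemma enlarged_null t A : measurable A -> P A = 0%E -> enlarged t A.
Proof. by move=> mA PA; apply: enlarged_past => // k; exact: past_null. Qed.

Lemma usual_conditions_enlarged : usual_conditions P enlarged.
Proof.
split; first split.
- by move=> t _; exact: enlarged_sigma.
- by move=> t _ A [].
- by move=> s t _; exact: enlarged_homo.
- by move=> t _; exact: enlarged_right_continuous.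
- by move=> A; exact: enlarged_null.
Qed.

Lemma enlarges_enlarged : enlarges F enlarged.
Proof.
move=> t t0 A FA; have fA := sub_filtration_infty t0 FA.
apply: enlarged_past; first exact: (filtration_infty_measurable usualF).
by move=> k; apply: sub_sigma_algebra; exact: sub_history.
Qed.

Lemma measurable_wrt_enlarged {d' : measure_display} {Y : measurableType d'}
    (f : T -> Y) (g : nat -> T -> Y) t :
  measurable_fun setT f -> (forall k, measurable_fun setT (g k : TH k -> Y)) ->
  (forall k w, (jumps t w <= k)%N -> f w = g k w) ->
  measurable_wrt (enlarged t) f.
Proof.
move=> mf mg fg _ [B mB <-]; split; first exact: mf.
move=> k; exists (setT `&` g k @^-1` B); first exact: (mg k).
by apply/seteqP; split => w /= [[_ h] wk]; split => //; split => //; move: h; rewrite (fg k).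
Qed.

(** Preimages under [f] and [g] differ only inside [N], and null events belong to [enlarged t]. This
    transfers adaptedness to the integral process of the original data. *)
Lemma measurable_wrt_ae {d' : measure_display} {Y : measurableType d'}
    (f g : T -> Y) (N : set T) t :
  measurable_wrt (enlarged t) f -> measurable_fun setT g -> measurable N -> P N = 0%E ->
  (forall w, ~ N w -> f w = g w) -> measurable_wrt (enlarged t) g.
Proof.
move=> mf mg mN PN fg _ [B mB <-]; rewrite setTI.
pose GT := g_sigma_algebraType (enlarged t).
have sG A : enlarged t A -> measurable (A : set GT) by exact: sub_sigma_algebra.
have Gs A : measurable (A : set GT) -> enlarged t A.
  by apply: smallest_sub => //; exact: enlarged_sigma.
have mgB : measurable (g @^-1` B) by rewrite -[X in measurable X]setTI; exact: mg.
apply: Gs; rewrite (_ : g @^-1` B = ((setT `&` f @^-1` B) `&` ~` N) `|` (g @^-1` B `&` N)).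
  apply: measurableU; first apply: measurableI.
  - by apply: sG; apply: mf; exists B.
  - by apply: measurableC; apply: sG; exact: enlarged_null.
  - apply: sG; apply: enlarged_null; first exact: measurableI.
    by apply: subset_measure0 PN => //; exact: measurableI.
apply/seteqP; split => w /=.
  move=> gB; have [Nw|Nw] := pselect (N w); first by right.
  by left; split => //; split => //; rewrite fg.
by move=> [[[_ +] nN]|[//]]; rewrite fg.
Qed.

Lemma measurable_jumps t : measurable_fun setT (jumps t).
Proof.
apply: (@measurableT_comp _ _ _ T (T * R)%type nat (fun p => jumps p.2 p.1) setT
  (fun w => (w, t))); [exact: measurable_jumps_joint | by []].
Qed.

Lemma adapted_jumps : adapted enlarged jumps.
Proof.
move=> t t0; apply: (measurable_wrt_enlarged (g := fun k w => minn (jumps t w) k)).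
- exact: measurable_jumps.
- move=> k; apply: (@measurableT_comp _ _ _ (TH k) (TH k * R)%type nat
    (fun p => minn (jumps p.2 p.1) k) setT (fun w => (w, t))); last by [].
  exact: measurable_jumps_past.
- by move=> k w /minn_idPl.
Qed.

(** * The martingale property *)

(** It uses X_s in place of X_{s-}: the two differ at countably many times of each path, which the
    time integral does not see. *)
Definition intensity (p : T * R) : R := rho (jumps p.2 p.1) p.

Definition compensator t w := cumul (fun s => intensity (w, s)) 0 t.

Lemma intensity_bounds p : 0 <= intensity p <= C.
Proof. exact: rho_bounds. Qed.

Lemma measurable_rho k : measurable_fun setT (rho k).
Proof. exact: (measurable_rate L_gt0 measurable_state (mlam k) (admissible_gam k)). Qed.

Lemma measurable_intensity : measurable_fun setT intensity.
Proof. exact: (measurable_select measurable_rho measurable_jumps_joint). Qed.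

Lemma measurable_intensity1 w : measurable_fun setT (fun s => intensity (w, s)).
Proof.
by apply: (@measurableT_comp _ _ _ R (T * R)%type R intensity); [exact: measurable_intensity|].
Qed.

Lemma compensator_ge0 t w : 0 <= compensator t w.
Proof. by apply: (cumul_ge0 (C := C)) => s; exact: intensity_bounds. Qed.

Lemma compensator_le t w : 0 <= t -> compensator t w <= C * t.
Proof.
move=> t0; rewrite -[X in _ <= C * X]subr0.
by apply: (cumul_le (@measurable_intensity1 w) (fun s => intensity_bounds (w, s))).
Qed.

Lemma compensator_lipschitz s t w : s <= t ->
  0 <= compensator t w - compensator s w <= C * (t - s).
Proof.
move=> st; rewrite subr_ge0; apply/andP; split.
  exact: (cumul_homo (@measurable_intensity1 w) (fun s => intensity_bounds (w, s))).
exact: (cumul_lipschitz (@measurable_intensity1 w) (fun s => intensity_bounds (w, s))).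
Qed.

Lemma measurable_compensator_of {d1 : measure_display} (S : measurableType d1)
    (f : S * R -> R) t :
  measurable_fun setT f -> (forall p, 0 <= f p) ->
  measurable_fun setT (fun w => cumul (fun s => f (w, s)) 0 t).
Proof.
move=> mf f0.
apply: (@measurableT_comp _ _ _ S (S * R)%type R
  (fun p => cumul (fun s => f (p.1, s)) 0 p.2) setT (fun w => (w, t))); last by [].
exact: (@measurable_cumul _ S R f (fun=> 0)).
Qed.

Lemma measurable_compensator t : measurable_fun setT (compensator t).
Proof.
apply: measurable_compensator_of; first exact: measurable_intensity.
by move=> p; have /andP[] := intensity_bounds p.
Qed.

(** On {X_t <= k} the path has visited only levels up to k before t, and the rates of those levels
    are known given H_k. *)
Lemma compensator_enlarged t : measurable_wrt (enlarged t) (compensator t).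
Proof.
(* The inner cap makes the number of jumps known given H_k; the outer one makes the selected rate
   measurable for H_k at every index, also those above k. *)
pose f k (p : T * R) := rho (minn (minn (jumps p.2 p.1) k) k) p.
apply: (measurable_wrt_enlarged (g := fun k w => cumul (fun s => f k (w, s)) 0 t)).
- exact: measurable_compensator.
- move=> k; apply: (@measurable_compensator_of _ (TH k) (f k)); last first.
    by move=> p; have /andP[] := rho_bounds (minn (minn (jumps p.2 p.1) k) k) p.
  apply: (@measurable_select _ _ (TH k * R)%type R (fun j => rho (minn j k))
    (fun p => minn (jumps p.2 p.1) k)); last exact: measurable_jumps_past.
  move=> j; have jk : (minn j k <= k)%N by exact: geq_minr.
  apply: (@measurableT_comp _ _ _ (TH k * R)%type (TH (minn j k) * R)%type R
    (rho (minn j k)) setT id); first exact: measurable_rho_past.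
  apply/measurable_fun_pairP; split; last exact: measurable_snd.
  apply: (@measurableT_comp _ _ _ (TH k * R)%type (TH k) (TH (minn j k)) id);
    last exact: measurable_fst.
  by move=> _ B mB; rewrite setTI; exact: (past_le jk).
- move=> k w tk; rewrite /compensator /cumul; apply: eq_Rintegral => s.
  rewrite inE /= in_itv /= => /andP[_ st]; rewrite /intensity /f /=.
  by have /minn_idPl e1 := leq_trans (jumps_homo w st) tk; rewrite !e1.
Qed.

(** At each time exactly one level is current, so the sum of the rates restricted to their levels
    collapses to the intensity; nonnegativity permits exchanging sum and integral. *)
Lemma step_compensator_series t w : good w ->
  (\sum_(0 <= k <oo) (step_compensator k t w)%:E = (compensator t w)%:E)%E.
Proof.
move=> gw; have E0 k : 0 <= E k w by apply: ltW; exact: gw.1.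
under eq_eseriesr do rewrite -(step_compensator_integral _ (E0 _)).
rewrite -integral_nneseries //; first last.
- by move=> k s _; rewrite lee_fin mulr_ge0 //; have /andP[] := rho_bounds k (w, s).
- move=> k; apply: measurable_funTS; apply/measurable_EFinP; apply: measurable_funM.
    by apply: measurable_natr; apply: measurable_and;
      [apply: measurable_fun_ler | apply: measurable_fun_ltr].
  exact: measurable_rho1.
rewrite /compensator /cumul /Rintegral fineK; last first.
  apply: integrable_fin_num => //.
  exact: (cumul_integrable (@measurable_intensity1 w) (fun s => intensity_bounds (w, s))).
apply: eq_integral => s; rewrite inE /= in_itv /= => /andP[s0 _].
transitivity (\sum_(0 <= k <oo) (if k == jumps s w then (intensity (w, s))%:E else 0%:E))%E.
  apply: eq_eseriesr => k _; rewrite -jumps_level // eq_sym.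
  by case: eqP => [->|_]; rewrite ?mul1r ?mul0r.
apply: cvg_lim => //; apply: cvg_near_cst; exists (jumps s w).+1 => // n /= jn.
rewrite big_mkord; rewrite (bigD1 (Ordinal jn)) //= eqxx big1 ?adde0 //.
by move=> i; rewrite -val_eqE /= => /negPf ->.
Qed.

(** Stated through E_k and the cumulative rate, the form in which freezing applies; on [good] it is
    the indicator of {tau_{k+1} <= t}. *)
Definition jumped k t w : R := (E k w <= cum k t w)%R%:R.

Lemma jumped_good k t w : good w -> (E k w <= cum k t w) = (tau k.+1 w <= t).
Proof.
move=> gw; apply/idP/idP => [h|/tauS_le[]//]; apply/tauS_le; split => //.
rewrite leNgt; apply/negP => tk; move: h; rewrite /cum cumul_lt //.
by rewrite leNgt gw.1.
Qed.

Lemma jumped_series t w : good w ->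
  (\sum_(0 <= k <oo) (jumped k t w)%:E = (jumps t w)%:R%:E :> \bar R)%E.
Proof.
move=> gw; rewrite -(series_failures (jumps_le t w)).
by apply: eq_eseriesr => k _; rewrite /jumped jumped_good // arrival_good // lte_fin -leNgt.
Qed.

Lemma measurable_jumped k t : measurable_fun setT (jumped k t).
Proof.
apply: measurable_natr; apply: measurable_fun_ler; first exact: measurable_funPT.
exact: measurable_cum.
Qed.

Lemma eq_integral_good (f g : T -> \bar R) : measurable_fun setT f ->
  measurable_fun setT g -> (forall w, good w -> f w = g w) ->
  (\int[P]_w f w = \int[P]_w g w)%E.
Proof.
move=> mf mg fg; apply: ae_eq_integral => //.
exists (~` good); split; [by apply: measurableC; exact: measurable_good | exact: good_ae |].
by move=> w h gw; apply: h => _; exact: fg.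
Qed.

(** The pointwise hypothesis says (1_A - 1_B)(u - v) = 0, written without subtraction because the
    integrals over [A] may still be infinite. Only the integral over [B] is cancelled, and that one
    is finite. *)
Lemma eq_integral_swap (A B : set T) (u v : T -> R) :
  measurable A -> measurable B -> measurable_fun setT u -> measurable_fun setT v ->
  (forall w, 0 <= u w) -> (forall w, 0 <= v w) ->
  (forall w, good w -> \1_A w * u w + \1_B w * v w = \1_A w * v w + \1_B w * u w) ->
  (\int[P]_w (\1_B w * u w)%:E = \int[P]_w (\1_B w * v w)%:E)%E ->
  (\int[P]_w (\1_B w * v w)%:E)%E \is a fin_num ->
  (\int[P]_w (\1_A w * u w)%:E = \int[P]_w (\1_A w * v w)%:E)%E.
Proof.
move=> mA mB mu' mv' u0 v0 key uvB finB.
have mind (D : set T) (f : T -> R) : measurable D -> measurable_fun setT f ->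
    measurable_fun setT (fun w => (\1_D w * f w)%:E : \bar R).
  by move=> mD mf; apply/measurable_EFinP; apply: measurable_funM.
have ind0 (D : set T) (f : T -> R) : (forall w, 0 <= f w) ->
    forall w, setT w -> (0 <= (\1_D w * f w)%:E)%E.
  by move=> f0 w _; rewrite lee_fin mulr_ge0.
have sumAB (f g : T -> R) : measurable_fun setT f -> measurable_fun setT g ->
    (forall w, 0 <= f w) -> (forall w, 0 <= g w) ->
    (\int[P]_w (\1_A w * f w)%:E + \int[P]_w (\1_B w * g w)%:E =
     \int[P]_w (\1_A w * f w + \1_B w * g w)%:E)%E.
  move=> mf mg f0 g0; rewrite -ge0_integralD //; do ?by apply: mind.
  - exact: ind0.
  - exact: ind0.
have : (\int[P]_w (\1_A w * u w)%:E + \int[P]_w (\1_B w * v w)%:E =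
        \int[P]_w (\1_A w * v w)%:E + \int[P]_w (\1_B w * u w)%:E)%E.
  rewrite !sumAB //; apply: eq_integral_good.
  - by apply/measurable_EFinP; apply: measurable_funD; apply/measurable_EFinP; apply: mind.
  - by apply/measurable_EFinP; apply: measurable_funD; apply/measurable_EFinP; apply: mind.
  - by move=> w gw; rewrite key.
rewrite uvB => /(congr1 (fun x => x - \int[P]_w (\1_B w * v w)%:E)%E).
by rewrite !addeK.
Qed.

(* On [jumps s <= k], i.e. before the (k+1)-st jump, A may be replaced by an
   event B of the past of that jump; afterwards both sides are frozen. *)
Lemma compensated_step k A s t : enlarged s A -> 0 <= s -> s <= t ->
  (\int[P]_w (\1_A w * (jumped k t w + step_compensator k s w))%:E =
   \int[P]_w (\1_A w * (jumped k s w + step_compensator k t w))%:E)%E.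
Proof.
move=> [mA /(_ k)[B pB AB]] s0 st.
have mB : measurable B by exact: (past_measurable usualF pB).
pose u w := jumped k t w + step_compensator k s w; pose v w := jumped k s w + step_compensator k t w.
have mu' : measurable_fun setT u.
  by apply: measurable_funD; [exact: measurable_jumped | exact: measurable_step_compensator].
have mv' : measurable_fun setT v.
  by apply: measurable_funD; [exact: measurable_jumped | exact: measurable_step_compensator].
have u0 w : 0 <= u w by rewrite addr_ge0 // step_compensator_ge0.
have v0 w : 0 <= v w by rewrite addr_ge0 // step_compensator_ge0.
have mind (D : set T) (f : T -> R) : measurable D -> measurable_fun setT f ->
    measurable_fun setT (fun w => (\1_D w * f w)%:E : \bar R).
  by move=> mD mf; apply/measurable_EFinP; apply: measurable_funM.
have key w : good w -> \1_A w * u w + \1_B w * v w = \1_A w * v w + \1_B w * u w.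
  move=> gw; have [sk|ks] := leqP (jumps s w) k.
    have <- : \1_A w = \1_B w :> R; last by rewrite addrC.
    rewrite !indicE; congr (_ %:R); congr nat_of_bool; apply/idP/idP; rewrite !inE => h.
      by have [] : (B `&` [set w | (jumps s w <= k)%N]) w by rewrite -AB.
    by have [] : (A `&` [set w | (jumps s w <= k)%N]) w by rewrite AB.
  have Es : E k w <= cum k s w.
    rewrite jumped_good // leNgt -lte_fin -arrival_good // -jumps_le -ltnNge //.
  have Et : E k w <= cum k t w by apply: le_trans Es _; exact: cum_homo.
  have -> : u w = v w.
    rewrite /u /v /jumped Es Et /step_compensator max_r; last by apply: ltW; exact: gw.1.
    by rewrite !min_l.
  by [].
have m1B : measurable_fun setT (\1_B : TH k -> R) by apply: measurable_indic; exact: pB.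
have B0 w : 0 <= \1_B w :> R by rewrite indicE.
(* By freezing, this integral equals that of an indicator and is at most 1. *)
have fin (x : R) : 0 <= x -> (\int[P]_w (\1_B w * step_compensator k x w)%:E)%E \is a fin_num.
  move=> x0; rewrite -(@compensator_expectation k x (\1_B) m1B B0).
  rewrite ge0_fin_numE; last by apply: integral_ge0 => w _; rewrite lee_fin mulr_ge0.
  apply: (@le_lt_trans _ _ (\int[P]_w (cst 1%E w))%E).
    apply: ge0_le_integral => //.
    - by apply: mind => //; exact: measurable_jumped.
    - move=> w _; rewrite lee_fin indicE.
      by case: (w \in B); case: (E k w <= _); rewrite ?mulr0 ?mul0r ?mulr1 ?ler01 ?lexx.
  rewrite integral_cst // mul1e.
  by rewrite [X in (X < _)%E](_ : _ = 1%E) ?ltry //; exact: probability_setT.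
have sumB (f g : T -> R) : measurable_fun setT f -> measurable_fun setT g ->
    (forall w, 0 <= f w) -> (forall w, 0 <= g w) ->
    (\int[P]_w (\1_B w * (f w + g w))%:E =
     \int[P]_w (\1_B w * f w)%:E + \int[P]_w (\1_B w * g w)%:E)%E.
  move=> mf mg f0 g0; rewrite -ge0_integralD //.
  - by apply: eq_integral => w _; rewrite mulrDr EFinD.
  - by move=> w _; rewrite lee_fin mulr_ge0.
  - exact: mind.
  - by move=> w _; rewrite lee_fin mulr_ge0.
  - exact: mind.
have EB (x : R) : (\int[P]_w (\1_B w * jumped k x w)%:E = \int[P]_w (\1_B w * step_compensator k x w)%:E)%E.
  exact: (@compensator_expectation k x (\1_B) m1B B0).
have uvE x y : (\int[P]_w (\1_B w * (jumped k x w + step_compensator k y w))%:E =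
    \int[P]_w (\1_B w * step_compensator k x w)%:E + \int[P]_w (\1_B w * step_compensator k y w)%:E)%E.
  rewrite -EB; apply: (sumB (jumped k x) (step_compensator k y)).
  - exact: measurable_jumped.
  - exact: measurable_step_compensator.
  - by move=> w; exact: ler0n.
  - by move=> w; exact: step_compensator_ge0.
have uvB : (\int[P]_w (\1_B w * u w)%:E = \int[P]_w (\1_B w * v w)%:E)%E.
  exact: (etrans (uvE t s) (etrans (addeC _ _) (esym (uvE s t)))).
have finB : (\int[P]_w (\1_B w * v w)%:E)%E \is a fin_num.
  apply: (eq_ind_r (fun x => x \is a fin_num) _ (uvE s t)).
  by rewrite fin_numD; apply/andP; split; [exact: fin s s0 | exact: fin t (le_trans s0 st)].
exact: (eq_integral_swap mA mB mu' mv' u0 v0 key uvB finB).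
Qed.

(** All terms are kept nonnegative so that the levels can be summed before X_t is known to be
    integrable. *)
Lemma compensated_sum A s t : enlarged s A -> 0 <= s -> s <= t ->
  (\int[P]_w (\1_A w * ((jumps t w)%:R + compensator s w))%:E =
   \int[P]_w (\1_A w * ((jumps s w)%:R + compensator t w))%:E)%E.
Proof.
move=> hA s0 st; have [mA _] := hA.
have series x y : (\int[P]_w (\1_A w * ((jumps x w)%:R + compensator y w))%:E =
    \sum_(0 <= k <oo) \int[P]_w (\1_A w * (jumped k x w + step_compensator k y w))%:E)%E.
  have mk k : measurable_fun setT (fun w => (\1_A w * (jumped k x w + step_compensator k y w))%:E).
    apply/measurable_EFinP; apply: measurable_funM => //.
    by apply: measurable_funD; [exact: measurable_jumped | exact: measurable_step_compensator].
  have k0 k w : (0 <= (\1_A w * (jumped k x w + step_compensator k y w))%:E :> \bar R)%E.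
    by rewrite lee_fin mulr_ge0 // addr_ge0 // step_compensator_ge0.
  rewrite -integral_nneseries //.
  apply: eq_integral_good.
  - apply/measurable_EFinP; apply: measurable_funM => //.
    apply: measurable_funD; last exact: measurable_compensator.
    by apply: (@measurableT_comp _ _ _ T nat R (fun n => n%:R)); last exact: measurable_jumps.
  - exact: ge0_emeasurable_sum.
  - move=> w gw; under eq_eseriesr do rewrite EFinM EFinD.
    rewrite nneseriesZl; last by move=> k _; rewrite -EFinD lee_fin addr_ge0 // step_compensator_ge0.
    rewrite nneseriesD; first last.
    + by move=> k _ _; rewrite lee_fin step_compensator_ge0.
    + by move=> k _ _; rewrite lee_fin.
    by rewrite jumped_series // step_compensator_series.
by rewrite !series; apply: eq_eseriesr => k _; exact: compensated_step.
Qed.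

Lemma bounded_compensator t w : 0 <= t -> `|compensator t w| <= C * t.
Proof. by move=> t0; rewrite ger0_norm ?compensator_ge0 // compensator_le. Qed.

Lemma compensator_integrable t : 0 <= t -> P.-integrable setT (EFin \o compensator t).
Proof.
move=> t0; apply: bounded_integrable (measurable_compensator t) _ => w.
exact: bounded_compensator.
Qed.

Lemma measurable_jumpsR t : measurable_fun setT (fun w => (jumps t w)%:R : R).
Proof.
by apply: (@measurableT_comp _ _ _ T nat R (fun n => n%:R)); last exact: measurable_jumps.
Qed.

Lemma jumps0 w : good w -> jumps 0 w = 0%N.
Proof.
move=> gw; apply/eqP; rewrite jumps_level // lexx /=.
by apply: (le_lt_trans (tau_ge0 0 w)); apply: tau_lt; exact: gw.1.
Qed.

Lemma jumps_integrable t : 0 <= t ->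
  P.-integrable setT (EFin \o (fun w => (jumps t w)%:R : R)).
Proof.
move=> t0; apply/integrableP; split; first by apply/measurable_EFinP; exact: measurable_jumpsR.
(* With the whole space and s = 0 the preceding identity bounds the expectation of X_t by that of
   the compensator, which is bounded. *)
have hT : enlarged 0 setT.
  apply: enlarged_past; first exact: measurableT.
  by move=> k; exact: (@measurableT _ (TH k)).
have m0 : measurable_fun setT (fun w => (\1_[set: T] w * ((jumps 0 w)%:R + compensator t w))%:E : \bar R).
  apply/measurable_EFinP; apply: measurable_funM; first exact: measurable_indic.
  by apply: measurable_funD; [exact: measurable_jumpsR | exact: measurable_compensator].
have m1 : measurable_fun setT (fun w => (\1_[set: T] w * ((jumps t w)%:R + compensator 0 w))%:E : \bar R).
  apply/measurable_EFinP; apply: measurable_funM; first exact: measurable_indic.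
  by apply: measurable_funD; [exact: measurable_jumpsR | exact: measurable_compensator].
apply: (@le_lt_trans _ _
  (\int[P]_w (\1_[set: T] w * ((jumps t w)%:R + compensator 0 w))%:E)%E).
  apply: ge0_le_integral => //.
  - by apply: measurableT_comp => //; apply/measurable_EFinP; exact: measurable_jumpsR.
  - move=> w _; rewrite indicT mul1r abse_EFin lee_fin ger0_norm // lerDl.
    exact: compensator_ge0.
rewrite (compensated_sum hT (lexx 0) t0).
rewrite (@eq_integral_good _ (fun w => (compensator t w)%:E)) //.
- apply: (@le_lt_trans _ _ `|\int[P]_w (compensator t w)%:E|)%E; first exact: lee_abs.
  by rewrite -fin_num_abs; apply: integrable_fin_num => //; exact: compensator_integrable.
- by apply/measurable_EFinP; exact: measurable_compensator.
- by move=> w gw; rewrite indicT mul1r jumps0 // add0r.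
Qed.

Section modification.
Variables (f g : T -> R) (N : set T).
Hypotheses (mf : measurable_fun setT f) (mg : measurable_fun setT g).
Hypotheses (mN : measurable N) (PN : P N = 0%E) (fg : forall w, ~ N w -> f w = g w).

Lemma integral_modification A : measurable A ->
  (\int[P]_(w in A) (f w)%:E = \int[P]_(w in A) (g w)%:E)%E.
Proof.
move=> mA; apply: ae_eq_integral => //.
- by apply: measurable_funTS; apply/measurable_EFinP.
- by apply: measurable_funTS; apply/measurable_EFinP.
- by exists N; split => // w h; apply: contrapT => nN; apply: h => _; rewrite fg.
Qed.

Lemma integrable_modification : P.-integrable setT (EFin \o g) ->
  P.-integrable setT (EFin \o f).
Proof.
move=> /integrableP[_ gi]; apply/integrableP; split; first exact/measurable_EFinP.
rewrite (_ : (\int[P]_w `|(EFin \o f) w|)%E = (\int[P]_w `|(EFin \o g) w|)%E) //.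
apply: ae_eq_integral => //.
- by apply: measurableT_comp => //; apply/measurable_EFinP.
- by apply: measurableT_comp => //; apply/measurable_EFinP.
- by exists N; split => // w h; apply: contrapT => nN; apply: h => _; rewrite /= fg.
Qed.

End modification.

Lemma measurable_wrt_enlargedP (f : T -> R) t :
  measurable_wrt (enlarged t) f <->
  measurable_fun setT (f : g_sigma_algebraType (enlarged t) -> R).
Proof.
split; first by move=> mf _ B mB; apply: sub_sigma_algebra; apply: mf; exists B.
move=> mf _ [B mB <-].
have : <<s enlarged t >> `<=` enlarged t by apply: smallest_sub => //; exact: enlarged_sigma.
by apply; exact: mf.
Qed.

Lemma integral_indicM (A : set T) (f : T -> R) :
  (\int[P]_(w in A) (f w)%:E = \int[P]_w (\1_A w * f w)%:E)%E.
Proof.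
rewrite integral_mkcond; apply: eq_integral => w _; rewrite patchE indicE.
by case: ifP => _; rewrite ?mul1r ?mul0r.
Qed.

Lemma compensated_integral A s t : enlarged s A -> 0 <= s -> s <= t ->
  (\int[P]_(w in A) ((jumps s w)%:R - compensator s w)%:E =
   \int[P]_(w in A) ((jumps t w)%:R - compensator t w)%:E)%E.
Proof.
move=> hA s0 st; have [mA _] := hA; have t0 := le_trans s0 st.
have := compensated_sum hA s0 st; rewrite -!integral_indicM.
have IX x : 0 <= x -> P.-integrable A (EFin \o (fun w => (jumps x w)%:R : R)).
  by move=> x0; apply: integrableS (jumps_integrable x0).
have IC x : 0 <= x -> P.-integrable A (EFin \o compensator x).
  by move=> x0; apply: integrableS (compensator_integrable x0).
rewrite (integralD_EFin mA (IX t t0) (IC s s0)) (integralD_EFin mA (IX s s0) (IC t t0)).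
rewrite (integralB_EFin mA (IX t t0) (IC t t0)) (integralB_EFin mA (IX s s0) (IC s s0)).
have := integrable_fin_num mA (IX t t0); have := integrable_fin_num mA (IC s s0).
have := integrable_fin_num mA (IX s s0); have := integrable_fin_num mA (IC t t0).
move: (integral _ _ (EFin \o compensator t)) (integral _ _ (EFin \o compensator s)) => a b.
move: (integral _ _ _) (integral _ _ _) => c c'.
case: a => [a| |] // _; case: c => [c| |] // _; case: b => [b| |] // _; case: c' => [c'| |] // _.
by move=> /= [h]; congr EFin; lra.
Qed.

Lemma compensator_cvg (t : R) w : 0 <= t ->
  compensator u w @[u --> t] --> compensator t w.
Proof.
move=> t0; apply/cvgrPdist_le => eps e0; near=> u.
(* Dividing by [C + 1] needs only [0 <= C]. *)
have tu : `|t - u| <= eps / (C + 1).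
  near: u; apply: (@cvgr_dist_le _ _ _ (nbhs t) _ id t); first exact: cvg_id.
  by rewrite divr_gt0 // ltr_wpDl // divr_ge0 ?mulr_ge0 ?(ltW L_gt0) ?(le_trans (ltW L_gt0)).
have C0 : 0 <= C by rewrite divr_ge0 ?mulr_ge0 ?(ltW L_gt0) // ?(le_trans (ltW L_gt0)).
apply: (@le_trans _ _ (C * `|t - u|)).
  case: (leP u t) => [ut|/ltW tu'].
    have /andP[h1 h2] := compensator_lipschitz w ut.
    by rewrite ger0_norm // (ger0_norm (_ : 0 <= t - u)) // subr_ge0.
  have /andP[h1 h2] := compensator_lipschitz w tu'.
  by rewrite distrC (distrC t) ger0_norm // (ger0_norm (_ : 0 <= u - t)) // subr_ge0.
apply: (le_trans (ler_wpM2l C0 tu)).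
rewrite mulrCA ler_piMr ?(ltW e0) // ler_pdivrMr ?mul1r ?lerDl ?ltr_wpDl //.
Unshelve. all: by end_near. Qed.

Lemma cadlag_modification (J : R -> R) w :
  (forall t, 0 <= t -> J t = compensator t w) ->
  cadlag (fun t => (jumps t w)%:R - J t).
Proof.
move=> JE.
have cl (t : R) : 0 <= t -> compensator u w @[u --> t^'-] --> compensator t w.
  by move=> t0; apply: cvg_at_left_filter; exact: compensator_cvg.
have cr (t : R) : 0 <= t -> compensator u w @[u --> t^'+] --> compensator t w.
  by move=> t0; apply: cvg_at_right_filter; exact: compensator_cvg.
split=> t t0.
  apply: cvgB; first by apply: cvg_near_cst; apply: filterS (jumps_near_right t w) => u ->.
  rewrite JE //; apply: cvg_trans (cr t t0); apply: near_eq_cvg; near=> u; rewrite JE //.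
  by apply: (le_trans t0); near: u; exact: nbhs_right_ge.
apply/cvg_ex; exists ((jumps_before t w)%:R - compensator t w).
apply: cvgB; first by apply: cvg_near_cst; apply: filterS (jumps_near_left t w) => u ->.
apply: cvg_trans (cl t (ltW t0)); apply: near_eq_cvg; near=> u; rewrite JE //.
by near: u; exact: nbhs_left_ge.
Unshelve. all: by end_near. Qed.

(** [J] stands for the integral formed with the original [eta] and [lambda]. One null set serves all
    times simultaneously, which the statement about paths requires. *)
Lemma martingale_jumps (J : R -> T -> R) (N : set T) :
  (forall t, 0 <= t -> measurable_fun setT (J t)) ->
  measurable N -> P N = 0%E ->
  (forall w, ~ N w -> forall t, 0 <= t -> J t w = compensator t w) ->
  martingale P enlarged (fun t w => (jumps t w)%:R - J t w).
Proof.
move=> mJ mN PN JE.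
have mM0 t : measurable_fun setT (fun w => (jumps t w)%:R - compensator t w : R).
  by apply: measurable_funB; [exact: measurable_jumpsR | exact: measurable_compensator].
have mM t : 0 <= t -> measurable_fun setT (fun w => (jumps t w)%:R - J t w : R).
  by move=> t0; apply: measurable_funB; [exact: measurable_jumpsR | exact: mJ].
have ME t : 0 <= t -> forall w, ~ N w ->
    (jumps t w)%:R - J t w = (jumps t w)%:R - compensator t w :> R.
  by move=> t0 w nN; rewrite JE.
have adM : adapted enlarged (fun t w => (jumps t w)%:R - J t w).
  move=> t t0; apply: (measurable_wrt_ae (f := fun w => (jumps t w)%:R - compensator t w)
    (N := N)) => //; [| exact: mM | by move=> w nN; rewrite ME].
  apply/measurable_wrt_enlargedP; apply: measurable_funB; last first.
    by apply/measurable_wrt_enlargedP; exact: compensator_enlarged.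
  move=> _ B mB; apply: sub_sigma_algebra; apply: adapted_jumps => //.
  by exists ((fun n : nat => n%:R) @^-1` B).
have IM (x : R) : 0 <= x -> P.-integrable setT (EFin \o (fun w => (jumps x w)%:R - J x w)).
  move=> t0; apply: (integrable_modification (mM x t0) (mM0 x) mN PN (ME x t0)).
  have := integrableB measurableT (jumps_integrable t0) (compensator_integrable t0).
  exact.
split=> //.
- move=> s t s0 st; have t0 := le_trans s0 st; split.
  + exact: IM.
  + exact: IM.
  + exact: adM.
  move=> A hA; have [mA _] := hA.
  rewrite (integral_modification (mM s s0) (mM0 s) mN PN (ME s s0) mA).
  rewrite (integral_modification (mM t t0) (mM0 t) mN PN (ME t t0) mA).
  exact: compensated_integral.
- exists N; split => // w h; apply: contrapT => nN; apply: h.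
  by apply: cadlag_modification => t t0; exact: JE.
Qed.

(** * The conditional expectation *)

Lemma level_sum s (h : nat -> T -> R) : 0 <= s ->
  (forall k, measurable_fun setT (h k)) -> (forall k w, 0 <= h k w) ->
  (\int[P]_w (h (jumps s w) w)%:E =
   \sum_(0 <= k <oo) \int[P]_w (h k w * (tau k w <= s < tau k.+1 w)%R%:R)%:E)%E.
Proof.
move=> s0 mh h0.
have mk k : measurable_fun setT (fun w => (h k w * (tau k w <= s < tau k.+1 w)%R%:R)%:E).
  apply/measurable_EFinP; apply: measurable_funM => //; apply: measurable_natr.
  apply: measurable_and.
    by apply: measurable_fun_ler => //; exact: measurable_tau.
  by apply: measurable_fun_ltr => //; exact: measurable_tau.
have k0 k w : (0 <= (h k w * (tau k w <= s < tau k.+1 w)%R%:R)%:E :> \bar R)%E.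
  by rewrite lee_fin mulr_ge0.
rewrite -integral_nneseries //; apply: eq_integral_good.
- apply/measurable_EFinP.
  by apply: (@measurable_select _ _ T R h (jumps s)); [exact: mh | exact: measurable_jumps].
- exact: ge0_emeasurable_sum.
- move=> w gw; apply/esym.
  transitivity (\sum_(0 <= k <oo) (if k == jumps s w then (h k w)%:E else 0%:E))%E.
    apply: eq_eseriesr => k _; rewrite -jumps_level // eq_sym.
    by case: eqP => [->|_]; rewrite ?mulr1 ?mulr0.
  apply: cvg_lim => //; apply: cvg_near_cst; exists (jumps s w).+1 => // n /= jn.
  rewrite big_mkord; rewrite (bigD1 (Ordinal jn)) //= eqxx big1 ?adde0 //.
  by move=> i; rewrite -val_eqE /= => /negPf ->.
Qed.

(** Testing against functions of X_s and summing [level_balance] over the levels gives the defining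
    identity of E[e_s | X_s]. *)
Lemma mimicking_level s (phi : nat -> R) : 0 <= s -> (forall k, 0 <= phi k) ->
  (\int[P]_w (phi (jumps s w) * e (w, s))%:E =
   \int[P]_w (phi (jumps s w) * gam (jumps s w) s)%:E)%E.
Proof.
move=> s0 phi0.
have e0 p : 0 <= e p by have /andP[+ _] := eLU p; apply: le_trans; exact: ltW.
have g0 k t : 0 <= gam k t.
  by have [_ /(_ t)/andP[+ _]] := admissible_gam k; apply: le_trans; exact: ltW.
have met : measurable_fun setT (fun w => e (w, s)).
  by apply: measurableT_comp => //; exact: measurable_state.
rewrite (level_sum (h := fun k w => phi k * e (w, s))) //; first last.
- by move=> k w; rewrite mulr_ge0.
- by move=> k; apply: measurable_funM.
rewrite (level_sum (h := fun k w => phi k * gam k s)) //; last first.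
- by move=> k w; rewrite mulr_ge0.
have mlev k : measurable_fun setT (fun w => (tau k w <= s < tau k.+1 w)%R%:R : R).
  apply: measurable_natr; apply: measurable_and.
    by apply: measurable_fun_ler => //; exact: measurable_tau.
  by apply: measurable_fun_ltr => //; exact: measurable_tau.
apply: eq_eseriesr => k _.
under eq_integral do rewrite -mulrA EFinM.
rewrite ge0_integralZl //; first last.
- by rewrite lee_fin.
- by move=> w _; rewrite lee_fin mulr_ge0.
- by apply/measurable_EFinP; apply: measurable_funM.
rewrite level_balance muleA -EFinM.
under [RHS]eq_integral do rewrite EFinM.
rewrite ge0_integralZl //; last by rewrite lee_fin mulr_ge0.
exact/measurable_EFinP.
Qed.

(** For a fixed path the two counts can differ only at an arrival time, so every section is
    countable and the set is null for the product measure. *)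
Lemma jumps_before_ae :
  {ae (P \x mu)%E, forall p : T * R, jumps p.2 p.1 = jumps_before p.2 p.1}.
Proof.
have mD : measurable [set p : T * R | jumps p.2 p.1 != jumps_before p.2 p.1].
  apply: measurable_bool_set; apply: measurable_neg; apply: measurable_fun_eqn.
    exact: measurable_jumps_joint.
  exact: measurable_jumps_before_joint.
exists [set p : T * R | jumps p.2 p.1 != jumps_before p.2 p.1]; split => //; last first.
  by move=> p /= /eqP.
apply: null_sections => // w; apply: countable_lebesgue_measure0.
(* [fine] sends infinite arrival times to 0, which at most adds one point to the countable set. *)
apply: (@sub_countable _ _ _ (range (fun k => fine (arrival k w)))); last first.
  exact: card_image_le.
apply: subset_card_le => s /=; apply: contraNP => nr; apply/eqP.
apply: count_failures_unique => k; rewrite jumps_before_le le_eqVlt.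
case: eqP => //= sk; case: nr; exists k => //.
by rewrite -sk.
Qed.

(** The balance identity concerns X_s, the conditioning X_{s-}. At a time s where they agree almost
    surely, the indicator of {X_{s-} in D} may be replaced by that of {X_s in D}. *)
Lemma cond_expectation_jumps (eta : R -> T -> R) s : 0 <= s ->
  measurable_fun setT (eta s) ->
  {ae P, forall w, eta s w = e (w, s)} ->
  {ae P, forall w, jumps s w = jumps_before s w} ->
  is_cond_expectation P (preimage_set_system [set: T] (left_limit jumps s) measurable)
    (eta s) (fun w => gam (left_limit jumps s w) s).
Proof.
move=> s0 meta eta_e jump_eq.
have -> : left_limit jumps s = jumps_before s.
  by apply/funext => w; exact: left_limit_jumps.
have mb : measurable_fun setT (jumps_before s).
  apply: (@measurableT_comp _ _ _ T (T * R)%type nat (fun p => jumps_before p.2 p.1) setT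
    (fun w => (w, s))); [exact: measurable_jumps_before_joint | by []].
have mZ : measurable_fun setT (fun w => gam (jumps_before s w) s).
  exact: (measurableT_comp (measurable_fun_nat (fun k => gam k s)) mb).
have met : measurable_fun setT (fun w => e (w, s)).
  by apply: measurableT_comp => //; exact: measurable_state.
have gLU k : L <= gam k s <= U by have [_] := admissible_gam k; apply.
split.
- have : P.-integrable setT (EFin \o (fun w => e (w, s))).
    apply: (bounded_integrable P (M := U)) => // w.
    have /andP[h1 h2] := eLU (w, s); rewrite ger0_norm //.
    by apply: le_trans h1; exact: ltW.
  move/integrableP => [_ Ie]; apply/integrableP; split; first exact/measurable_EFinP.
  rewrite (_ : (\int[P]_w `|(EFin \o eta s) w|)%E = (\int[P]_w `|(e (w, s))%:E|)%E) //.
  apply: ae_eq_integral => //.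
  + by apply: measurableT_comp => //; apply/measurable_EFinP.
  + by apply: measurableT_comp => //; apply/measurable_EFinP.
  + by apply: filterS eta_e => w /= -> _.
- apply: (bounded_integrable P (M := U)) => // w.
  have /andP[h1 h2] := gLU (jumps_before s w); rewrite ger0_norm //.
  by apply: le_trans h1; exact: ltW.
- move=> _ [B mB <-]; exists ((fun k => gam k s) @^-1` B) => //.
- move=> _ [D _ <-]; rewrite setTI.
  pose phi (k : nat) : R := \1_D k.
  have mA : measurable (jumps_before s @^-1` D).
    by rewrite -[X in measurable X]setTI; exact: mb.
  have mphi (f : T -> R) : measurable_fun setT f ->
      measurable_fun setT (fun w => (phi (jumps s w) * f w)%:E).
    move=> mf; apply/measurable_EFinP; apply: measurable_funM => //.
    exact: (measurableT_comp (measurable_fun_nat phi) (@measurable_jumps s)).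
  have E1 (f : T -> R) (g : T -> R) : measurable_fun setT f -> measurable_fun setT g ->
      {ae P, forall w, f w = g w} ->
      (\int[P]_(w in jumps_before s @^-1` D) (f w)%:E =
       \int[P]_w (phi (jumps s w) * g w)%:E)%E.
    move=> mf mg fg; rewrite integral_mkcond; apply: ae_eq_integral => //.
    + by apply/(measurable_restrictT _ _).1 => //; apply: measurable_funTS; apply/measurable_EFinP.
    + exact: mphi.
    + apply: filterS2 fg jump_eq => w fw jw _.
      rewrite patchE /phi indicE jw fw.
      have -> : (w \in jumps_before s @^-1` D) = (jumps_before s w \in D).
        by apply/idP/idP; rewrite !inE.
      by case: (_ \in D); rewrite ?mul1r ?mul0r.
  rewrite (E1 (fun w => gam (jumps_before s w) s) (fun w => gam (jumps s w) s) mZ); first last.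
  + by apply: filterS jump_eq => w ->.
  + exact: (measurableT_comp (measurable_fun_nat (fun k => gam k s)) (@measurable_jumps s)).
  rewrite (E1 (eta s) (fun w => e (w, s)) meta met eta_e).
  have phi0 k : 0 <= phi k by rewrite /phi indicE.
  exact: esym (mimicking_level s0 phi0).
Qed.

End jump_times.

(** * From clipped data back to the given ones *)

Theorem theorem3p2 (d : measure_display) (T : measurableType d) (R : realType)
    (P : probability T R) (F : R -> set_system T) (L U : R)
    (eta : R -> T -> R) (lambda : R -> nat -> R) (E : nat -> {RV P >-> R})
    (usualF : usual_conditions P F) (L_gt0 : 0 < L) (L_lt_U : L < U)
    (eta_pred : predictable F eta)
    (eta_bnd : {ae (P \x lebesgue_measure)%E, forall p : T * R,
                  0 <= p.2 -> L <= eta p.2 p.1 <= U})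
    (lambda_meas : measurable_time_state lambda)
    (lambda_ge0 : forall t x, 0 <= t -> 0 <= lambda t x)
    (lambda_bnd : forall x, {ae lebesgue_measure, forall t : R,
                               0 <= t -> L <= lambda t x <= U})
    (E_exp : forall k, exp1_distributed P (E k))
    (E_indep : mutually_independent P E)
    (E_F_indep : independent_classes P (sigma_of_sequence E)
                   (filtration_infty F)) :
  exists (G : R -> set_system T) (X : R -> T -> nat) (gamma : R -> nat -> R),
    usual_conditions P G /\ enlarges F G /\
    counting_process P X /\ adapted G X /\
    [/\ measurable_time_state gamma,
        forall s x, 0 <= s -> 0 < gamma s x,
        {ae lebesgue_measure, forall s : R, 0 <= s ->
           is_cond_expectation P
             (preimage_set_system [set: T] (left_limit X s) measurable)
             (eta s) (fun w => gamma s (left_limit X s w))}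
      & martingale P G (fun t w => (X t w)%:R -
          \int[lebesgue_measure]_(s in `[0, t])
            (eta s w / gamma s (left_limit X s w) *
             lambda s (left_limit X s w)))].
Proof.
have L_le_U := ltW L_lt_U.
pose D : set (T * R) := [set: T] `*` (`[0, +oo[ : set R).
have mD : measurable D by apply: measurableX.
(* Values at negative times are unconstrained; they are set to 0 before clipping so that the data
   become measurable on the whole line. *)
pose eta0 : T * R -> R := (fun p => eta p.2 p.1) \_ D.
pose lam0 (k : nat) : R -> R := (lambda ^~ k) \_ `[0, +oo[.
pose e p := Num.max L (Num.min U (eta0 p)).
pose lam k t := Num.max L (Num.min U (lam0 k t)).
(* No E_j enters H_0, which is F_oo; measurability at this level passes to every H_k. *)
have meta0 : measurable_fun setT (eta0 : g_sigma_algebraType (history F E 0) * R -> R).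
  have mD0 : measurable (D : set (g_sigma_algebraType (history F E 0) * R)).
    by apply: measurableX => //; exact: measurableT.
  have Fh t : 0 <= t -> F t `<=` <<s history F E 0 >>.
    move=> t0 A FA; apply: sub_sigma_algebra; apply: sub_history.
    exact: sub_filtration_infty t0 A FA.
  have mp := @measurable_predictable d T R F (history F E 0) eta Fh eta_pred.
  exact: (measurable_restrictT _ mD0).1 mp.
have me : measurable_fun setT (e : g_sigma_algebraType (history F E 0) * R -> R).
  by apply: measurable_maxr => //; apply: measurable_minr.
have eLU p : L <= e p <= U by exact: clip_bounds.
have mlam0 k : measurable_fun setT (lam0 k).
  apply/(measurable_restrictT _ _).1 => // _ B mB.
  have mlB := lambda_meas (measurableX (measurable_itv `[0, +oo[) measurableT) B mB.
  have := measurable_ysection k mlB; congr (measurable _).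
  by apply/seteqP; split => t; rewrite /ysection /= inE /=; [move=> [[]]|move=> []].
have mlam k : measurable_fun setT (lam k).
  by apply: measurable_maxr => //; apply: measurable_minr.
have lamLU k t : L <= lam k t <= U by exact: clip_bounds.
have mstate := measurable_state usualF me.
pose G := enlarged F E e lam L U.
pose X := jumps E e lam L U.
pose gamma s k := gam E e lam L U k s.
have Ag k := admissible_gam usualF L_gt0 L_le_U me eLU mlam lamLU k.
have gamma_gt0 s k : 0 < gamma s k.
  by have [_ /(_ s)/andP[+ _]] := Ag k; exact: lt_le_trans.
have etaE s w : 0 <= s -> eta s w = eta0 (w, s).
  by move=> s0; rewrite /eta0 patchE ifT // inE /D /= in_itv /= s0.
have lamE s k : 0 <= s -> lambda s k = lam0 k s.
  by move=> s0; rewrite /lam0 patchE ifT // inE /= in_itv /= s0.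
have eta_e : {ae (P \x lebesgue_measure)%E, forall p : T * R, 0 <= p.2 -> eta p.2 p.1 = e p}.
  have [N [mN N0 hN]] := eta_bnd; exists N; split => // -[w s] /= np; apply: hN => /= h.
  by apply: np => s0; rewrite /e -etaE // clip_id // h.
have lam_e : {ae lebesgue_measure, forall t : R, forall k, 0 <= t -> lambda t k = lam k t}.
  apply: ae_foralln => k; have [N [mN N0 hN]] := lambda_bnd k; exists N; split => // t /= nt.
  by apply: hN => /= h; apply: nt => t0; rewrite /lam -lamE // clip_id // h.
have Xb := jumps_before_ae usualF L_gt0 L_le_U me eLU mlam lamLU E_indep E_F_indep E_exp.
have [eta_e1 eta_e2] := ae_sections eta_e.
have [Xb1 Xb2] := ae_sections Xb.
have XL s w : left_limit X s w = jumps_before E e lam L U s w.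
  exact: left_limit_jumps usualF L_gt0 L_le_U me eLU mlam lamLU s w.
(* Built from the unclipped data, [f] has the integral [J] for every path, not only almost surely;
   this gives the measurability of [J]. *)
pose f p := eta0 p / gamma p.2 (jumps_before E e lam L U p.2 p.1)
  * lam0 (jumps_before E e lam L U p.2 p.1) p.2.
have mb := measurable_jumps_before_joint usualF L_gt0 L_le_U me eLU mlam lamLU E_indep E_F_indep E_exp.
have mf : measurable_fun setT f.
  apply: measurable_funM; first apply: measurable_funM.
  - apply: (@measurableT_comp _ _ _ (T * R)%type
      (g_sigma_algebraType (history F E 0) * R)%type R eta0 setT id meta0).
    apply/measurable_fun_pairP; split; last exact: measurable_snd.
    apply: (@measurableT_comp _ _ _ (T * R)%type T (g_sigma_algebraType (history F E 0)) id);
      last exact: measurable_fst.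
    by move=> _ B mB; rewrite setTI; exact: (@past_measurable _ _ _ P F E usualF 0 B mB).
  - apply: measurable_inv_pos => //.
    apply: (@measurable_select _ _ (T * R)%type R (fun k p => gamma p.2 k)) => // k.
    by apply: measurableT_comp => //; have [] := Ag k.
  - apply: (@measurable_select _ _ (T * R)%type R (fun k p => lam0 k p.2)) => // k.
    by apply: measurableT_comp => //; exact: mlam0.
pose J t w := \int[lebesgue_measure]_(s in `[0, t])
  (eta s w / gamma s (left_limit X s w) * lambda s (left_limit X s w)).
have JE t w : J t w = \int[lebesgue_measure]_(s in `[0, t]) f (w, s).
  apply: eq_Rintegral => s; rewrite inE /= in_itv /= => /andP[s0 _].
  by rewrite /f /= XL etaE // lamE.
have mJ t : 0 <= t -> measurable_fun setT (J t).
  move=> t0; rewrite (_ : J t = fun w => \int[lebesgue_measure]_(s in `[0, t]) f (w, s)).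
    exact: measurable_Rintegral_itv.
  by apply/funext => w; exact: JE.
have [N [mN PN JN]] : exists N, [/\ measurable N, P N = 0%E &
    forall w, ~ N w -> forall t, 0 <= t -> J t w = compensator E e lam L U t w].
  (* For almost every path the two integrands agree at almost every time, hence the integrals agree
     for all t at once. *)
  have : {ae P, forall w, forall t, 0 <= t -> J t w = compensator E e lam L U t w}.
    apply: filterS2 eta_e1 Xb1 => w ew bw t t0; rewrite JE /compensator /cumul /Rintegral.
    congr fine; apply: ae_eq_integral => //.
    - apply: measurable_funTS; apply/measurable_EFinP.
      exact: (measurableT_comp mf).
    - apply: measurable_funTS; apply/measurable_EFinP.
      exact: (measurable_intensity1 usualF L_gt0 L_le_U me eLU mlam lamLU).
    - apply: filterS3 ew bw lam_e => s /= es bs ls; rewrite in_itv /= => /andP[s0 _].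
      rewrite /f /intensity /rho /rate /= -bs -lamE // ls // -etaE // es //.
      by rewrite /gamma mulrAC.
  move=> [N [mN PN JN]]; exists N; split => // w nN; apply: contrapT => h.
  by apply: nN; apply: JN.
exists G, X, gamma; split.
  exact: (usual_conditions_enlarged usualF L_gt0 L_le_U me eLU mlam lamLU).
split.
  exact: (@enlarges_enlarged d T R P F E e lam L U usualF).
split.
  exact: (counting_process_jumps usualF L_gt0 L_le_U me eLU mlam lamLU E_indep E_F_indep E_exp).
split.
  exact: (adapted_jumps usualF L_gt0 L_le_U me eLU mlam lamLU E_indep E_F_indep E_exp).
split.
- apply: measurable_funTS.
  apply: (@measurable_select _ _ (R * nat)%type R (fun k p => gamma p.1 k) snd) => //.
  by move=> k; apply: measurableT_comp => //; have [] := Ag k.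
- by move=> s x _.
(* Sectioning in the other order gives, for almost every s, the almost sure identities eta_s = e_s
   and X_s = X_{s-}. *)
- apply: filterS2 eta_e2 Xb2 => s es bs s0.
  apply: (cond_expectation_jumps usualF L_gt0 L_le_U me eLU mlam lamLU E_indep E_F_indep E_exp) => //.
  + rewrite (_ : eta s = fun w => eta0 (w, s)); last by apply/funext => w; exact: etaE.
    apply: (measurable_past usualF (k := 0) (E := E)).
    exact: (measurableT_comp meta0).
  + by apply: filterS es => w; apply.
- exact: (martingale_jumps usualF L_gt0 L_le_U me eLU mlam lamLU E_indep E_F_indep E_exp mJ mN PN JN).
Qed.
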